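(* Let $k$ be an algebraically closed field of characteristic zero and $A=k\langle x,y\rangle/(x^3-1,y^2-1)$. Let $$\mathcal{F}:\qquad 0\to W\xrightarrow{\ \epsilon\ }E\xrightarrow{\ \pi\ }V\to0$$ be a non-split short exact sequence of finite-dimensional left $A$-modules with $Hom_A(V,W)=Hom_A(W,V)=0$ and $End_A(V)\simeq End_A(W)\simeq k$. Let $\beta$ and $\gamma$ be the dimension vectors of $W$ and $V$ respectively. Then $$\dim Ext^1_{\Lambda_2}(\mathcal{F},\mathcal{F})=1-\langle\beta+\gamma,\beta+\gamma\rangle+\langle\beta,\gamma\rangle.$$
   Context: $A$ is the group algebra of $PSL(2,\mathbf{Z})\simeq\mathbf{Z}_3*\mathbf{Z}_2$. The dimension vector of a finite-dimensional $A$-module $M$ is $\alpha=(\alpha_1,\alpha_2,\alpha_3;\alpha_1',\alpha_2')$, where $\alpha_1,\alpha_2,\alpha_3$ are the dimensions of the eigenspaces of $x$ for the three cube roots of unity (in a fixed order) and $\alpha_1',\alpha_2'$ are the dimensions of the eigenspaces of $y$ for the two square roots of unity (in a fixed order); so $\alpha_1+\alpha_2+\alpha_3=\alpha_1'+\alpha_2'=\dim_kM$. Put $$\langle\alpha,\beta\rangle=\sum_{i=1}^3\alpha_i\beta_i+\sum_{j=1}^2\alpha_j'\beta_j'-\Big(\sum_{i=1}^3\alpha_i\Big)\Big(\sum_{i=1}^3\beta_i\Big).$$ Let $\Lambda_2=\{0\le1\le2\}$. The exact sequence $\mathcal{F}$ is viewed as a presheaf (contravariant functor) of left $A$-modules on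 $\Lambda_2$ by $\mathcal{F}(2)=W$, $\mathcal{F}(1)=E$, $\mathcal{F}(0)=V$, $\mathcal{F}(0\le1)=\pi$, $\mathcal{F}(1\le2)=\epsilon$. For presheaves $\mathcal{F},\mathcal{G}$ on a poset $\Lambda$, put $K^{p,q}=\prod_{\lambda_0\le\cdots\le\lambda_p}C^q(A,Hom_k(\mathcal{F}(\lambda_p),\mathcal{G}(\lambda_0)))$, where $C^q(A,H)=Hom_k(A^{\otimes q},H)$ is the Hochschild cochain complex. Its differentials are the Hochschild differential $d:K^{p,q}\to K^{p,q+1}$ and $\delta:K^{p,q}\to K^{p+1,q}$, $$\delta\psi(\lambda_0\le\cdots\le\lambda_{p+1})=\mathcal{G}(\lambda_0\le\lambda_1)\psi(\lambda_1\le\cdots\le\lambda_{p+1})+\sum_{i=1}^p(-1)^i\psi(\lambda_0\le\cdots\le\widehat{\lambda_i}\le\cdots\le\lambda_{p+1})+(-1)^{p+1}\psi(\lambda_0\le\cdots\le\lambda_p)\mathcal{F}(\lambda_p\le\lambda_{p+1}).$$ The total differential is $\partial=d+(-1)^q\delta$ on $K^{p,q}$, and $Ext_\Lambda^n(\mathcal{F},\mathcal{G})=H^n(Tot(K^{\bullet\bullet}))$. *)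

(* Defs.v *)
From HB Require Import structures.
From mathcomp Require Import all_boot all_order all_algebra.
From mathcomp Require Import generic_quotient ring_quotient.
From mathcomp Require Import boolp.
From mathcomp.multinomials Require Import monalg.

Set Implicit Arguments.
Unset Strict Implicit.
Unset Printing Implicit Defensive.

Import Order.TTheory GRing.Theory.

Local Open Scope ring_scope.

Inductive two_sided_ideal (R : nzRingType) (S : R -> Prop) : R -> Prop :=
| TSI_gen r : S r -> two_sided_ideal S r
| TSI_0 : two_sided_ideal S 0
| TSI_add r s :
    two_sided_ideal S r -> two_sided_ideal S s -> two_sided_ideal S (r + s)
| TSI_mul a r b : two_sided_ideal S r -> two_sided_ideal S (a * r * b).

Section ModularAlgebra.
Variable k : fieldType.

(* k<x,y> is the monoid algebra over k of the free monoid on two letters;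
   the letter [true] is x and the letter [false] is y.                   *)
Definition free_alg := {malg k[{fmonom bool}]}.
Definition free_x : free_alg := << fmu true >>.
Definition free_y : free_alg := << fmu false >>.

Definition modular_relator (r : free_alg) : Prop :=
  r = free_x ^+ 3 - 1 \/ r = free_y ^+ 2 - 1.

Definition modular_ideal : {pred free_alg} :=
  fun r => `[< two_sided_ideal modular_relator r >].

Lemma modular_idealP r :
  reflect (two_sided_ideal modular_relator r) (r \in modular_ideal).
Proof. exact: asboolP. Qed.

Lemma modular_idealMM a r b :
  r \in modular_ideal -> a * r * b \in modular_ideal.
Proof. by move=> /modular_idealP Ir; apply/modular_idealP/TSI_mul. Qed.

Lemma modular_idealMl a r : r \in modular_ideal -> a * r \in modular_ideal.
Proof. by move=> /(modular_idealMM a 1); rewrite mulr1. Qed.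

Lemma modular_idealMr r b : r \in modular_ideal -> r * b \in modular_ideal.
Proof. by move=> /(modular_idealMM 1 b); rewrite mul1r. Qed.

Fact modular_ideal_zmod_closed : zmod_closed modular_ideal.
Proof.
split=> [|r s Ir Is]; first by apply/modular_idealP/TSI_0.
apply/modular_idealP/TSI_add; first exact/modular_idealP.
by apply/modular_idealP; rewrite -mulN1r; apply: modular_idealMl.
Qed.
HB.instance Definition _ :=
  GRing.isZmodClosed.Build free_alg modular_ideal modular_ideal_zmod_closed.

Fact trivial_mmorphism : mmorphism (fun _ : {fmonom bool} => 1 : k).
Proof. by split=> [m1 m2|]; rewrite ?mulr1. Qed.

(* The augmentation x, y |-> 1 shows that the ideal is proper. *)
Fact modular_ideal1 : 1 \notin modular_ideal.
Proof.
pose h : {mmorphism {fmonom bool} -> k} :=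
  HB.pack (fun _ : {fmonom bool} => 1 : k)
    (isMultiplicative.Build _ _ (fun _ : {fmonom bool} => 1 : k)
       trivial_mmorphism).
pose aug : {rmorphism free_alg -> k} := mmap idfun h.
have augU b : aug << fmu b >> = 1.
  by rewrite /aug /= mmapU /= mulr1.
apply/negP => /modular_idealP; suff H r :
    two_sided_ideal modular_relator r -> aug r = 0.
  by move/H/eqP; rewrite rmorph1 oner_eq0.
elim=> {r} [r [->|->]||r s _ Hr _ Hs|a r b _ Hr].
- by rewrite rmorphB rmorphXn augU expr1n rmorph1 subrr.
- by rewrite rmorphB rmorphXn augU expr1n rmorph1 subrr.
- by rewrite rmorph0.
- by rewrite rmorphD Hr Hs addr0.
- by rewrite !rmorphM Hr mulr0 mul0r.
Qed.

(* A = k<x,y>/(x^3 - 1, y^2 - 1) *)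
Definition modular_alg := Quotient.quot modular_ideal.
HB.instance Definition _ := GRing.Zmodule.on modular_alg.

Local Open Scope quotient_scope.
Definition modular_pi (r : free_alg) : modular_alg :=
  \pi_(Quotient.quot modular_ideal) r.
Definition modular_repr (u : modular_alg) : free_alg :=
  repr (u : Quotient.quot modular_ideal).

Lemma modular_reprK : cancel modular_repr modular_pi.
Proof. by move=> u; apply: reprK. Qed.

Lemma modular_piP r s : reflect (modular_pi r = modular_pi s)
  (r - s \in modular_ideal).
Proof. by apply: (iffP idP); rewrite Quotient.idealrBE => /eqP. Qed.

Lemma modular_piB r s : modular_pi (r - s) = modular_pi r - modular_pi s.
Proof. exact: (raddfB (\pi_(Quotient.quot modular_ideal))). Qed.

Lemma modular_piD r s : modular_pi (r + s) = modular_pi r + modular_pi s.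
Proof. exact: (raddfD (\pi_(Quotient.quot modular_ideal))). Qed.

Definition modular_one := modular_pi 1.
Definition modular_mul u v := modular_pi (modular_repr u * modular_repr v).
Definition modular_scale (c : k) u := modular_pi (c *: modular_repr u).

Lemma modular_piM r s :
  modular_pi (r * s) = modular_mul (modular_pi r) (modular_pi s).
Proof.
apply/modular_piP; set r' := modular_repr _; set s' := modular_repr _.
have Ir : r - r' \in modular_ideal by apply/modular_piP; rewrite modular_reprK.
have Is : s - s' \in modular_ideal by apply/modular_piP; rewrite modular_reprK.
have -> : r * s - r' * s' = (r - r') * s + r' * (s - s').
  by rewrite mulrBl mulrBr addrA subrK.
by apply: rpredD; [apply: modular_idealMr | apply: modular_idealMl].
Qed.

Lemma modular_piZ c r : modular_pi (c *: r) = modular_scale c (modular_pi r).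
Proof.
apply/modular_piP; rewrite -scalerBr -mul_malgC modular_idealMl //.
by apply/modular_piP; rewrite modular_reprK.
Qed.

Fact modular_mulA : associative modular_mul.
Proof.
move=> u v w; rewrite -[u]modular_reprK -[v]modular_reprK -[w]modular_reprK.
by rewrite -!modular_piM mulrA.
Qed.

Fact modular_mul1 : left_id modular_one modular_mul.
Proof. by move=> u; rewrite -[u]modular_reprK -modular_piM mul1r. Qed.

Fact modular_mulr1 : right_id modular_one modular_mul.
Proof. by move=> u; rewrite -[u]modular_reprK -modular_piM mulr1. Qed.

Fact modular_mulDl : left_distributive modular_mul +%R.
Proof.
move=> u v w; rewrite -[u]modular_reprK -[v]modular_reprK -[w]modular_reprK.
by rewrite -modular_piD -!modular_piM -modular_piD mulrDl.
Qed.

Fact modular_mulDr : right_distributive modular_mul +%R.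
Proof.
move=> u v w; rewrite -[u]modular_reprK -[v]modular_reprK -[w]modular_reprK.
by rewrite -modular_piD -!modular_piM -modular_piD mulrDr.
Qed.

Fact modular_one_neq0 : modular_one != 0.
Proof.
apply/eqP => one0; have /modular_piP : modular_pi 1 = modular_pi 0.
  rewrite -/modular_one one0; apply/esym.
  exact: (raddf0 (\pi_(Quotient.quot modular_ideal))).
by rewrite subr0; apply/negP/modular_ideal1.
Qed.

HB.instance Definition _ := GRing.Zmodule_isNzRing.Build modular_alg
  modular_mulA modular_mul1 modular_mulr1 modular_mulDl modular_mulDr
  modular_one_neq0.

Fact modular_scaleA a b u :
  modular_scale a (modular_scale b u) = modular_scale (a * b) u.
Proof. by rewrite -[u]modular_reprK -!modular_piZ scalerA. Qed.

Fact modular_scale1 : left_id 1 modular_scale.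
Proof. by move=> u; rewrite -[u]modular_reprK -!modular_piZ scale1r. Qed.

Fact modular_scaleDr : right_distributive modular_scale +%R.
Proof.
move=> c u v; rewrite -[u]modular_reprK -[v]modular_reprK.
by rewrite -modular_piD -!modular_piZ -modular_piD scalerDr.
Qed.

Fact modular_scaleDl u : {morph modular_scale^~ u : a b / a + b}.
Proof.
by move=> a b; rewrite -[u]modular_reprK -!modular_piZ -modular_piD scalerDl.
Qed.

HB.instance Definition _ := GRing.Zmodule_isLmodule.Build k modular_alg
  modular_scaleA modular_scale1 modular_scaleDr modular_scaleDl.

Lemma modular_pi_mul r s : modular_pi (r * s) = modular_pi r * modular_pi s.
Proof. exact: modular_piM. Qed.

Lemma modular_pi_scale c r : modular_pi (c *: r) = c *: modular_pi r.
Proof. exact: modular_piZ. Qed.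

Fact modular_scaleAl (c : k) (u v : modular_alg) : c *: (u * v) = (c *: u) * v.
Proof.
rewrite -[u]modular_reprK -[v]modular_reprK.
by rewrite -modular_pi_mul -!modular_pi_scale -modular_pi_mul scalerAl.
Qed.

HB.instance Definition _ :=
  GRing.Lmodule_isLalgebra.Build k modular_alg modular_scaleAl.

Lemma free_alg_constC (c : k) (r : free_alg) : c%:MP * r = r * c%:MP.
Proof.
rewrite !malgM_def fgmulUg fgmulgU; apply: eq_bigr => m _.
by rewrite mul1m mulm1 mulrC.
Qed.

Fact modular_scaleAr (c : k) (u v : modular_alg) : c *: (u * v) = u * (c *: v).
Proof.
rewrite -[u]modular_reprK -[v]modular_reprK.
rewrite -modular_pi_mul -!modular_pi_scale -modular_pi_mul.
by rewrite -!mul_malgC !mulrA free_alg_constC.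
Qed.

HB.instance Definition _ :=
  GRing.Lalgebra_isAlgebra.Build k modular_alg modular_scaleAr.

Definition modular_x : modular_alg := modular_pi free_x.
Definition modular_y : modular_alg := modular_pi free_y.

End ModularAlgebra.

Record fdmodule (k : fieldType) (A : algType k) := FdModule {
  fdm_space :> vectType k;
  fdm_act : {linear A -> 'End(fdm_space)};
  fdm_act1 : fdm_act 1 = \1%VF;
  fdm_actM : forall a b, fdm_act (a * b) = (fdm_act a \o fdm_act b)%VF
}.
Arguments fdm_act {k A} M : rename.

Section Modules.
Variables (k : fieldType) (A : algType k).
Implicit Types M N P : fdmodule A.

Definition amod_hom M N (f : 'Hom(M, N)) : Prop :=
  forall a : A, (f \o fdm_act M a = fdm_act N a \o f)%VF.

Definition hom_zero M N : Prop := forall f : 'Hom(M, N), amod_hom f -> f = 0.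

(* End_A(M) and k are isomorphic as k-algebras. *)
Definition end_iso_base M : Prop :=
  exists f : {linear k^o -> 'End(M)},
    [/\ f 1 = \1%VF,
        forall a b : k, f (a * b) = (f a \o f b)%VF,
        injective f
      & forall g : 'End(M), amod_hom g <-> exists a : k, f a = g].

Definition short_exact M N P (eps : 'Hom(M, N)) (pi : 'Hom(N, P)) : Prop :=
  [/\ lker eps = 0%VS, limg eps = lker pi & limg pi = fullv].

Definition split_epi N P (pi : 'Hom(N, P)) : Prop :=
  exists2 s : 'Hom(P, N), amod_hom s & (pi \o s = \1)%VF.

Lemma amod_hom0 M N : amod_hom (0 : 'Hom(M, N)).
Proof. by move=> a; rewrite comp_lfun0l comp_lfun0r. Qed.

Lemma amod_hom1 M : amod_hom (\1%VF : 'End(M)).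
Proof. by move=> a; rewrite comp_lfun1l comp_lfun1r. Qed.

Lemma amod_hom_comp M N P (g : 'Hom(N, P)) (f : 'Hom(M, N)) :
  amod_hom g -> amod_hom f -> amod_hom (g \o f)%VF.
Proof. by move=> Hg Hf a; rewrite -comp_lfunA Hf comp_lfunA Hg comp_lfunA. Qed.

End Modules.

Definition dimvec := ({ffun 'I_3 -> nat} * {ffun 'I_2 -> nat})%type.

(* [w] lists the cube roots of unity and [s] the square roots of unity. *)
Definition dim_vector (k : fieldType) (w : 3.-tuple k) (s : 2.-tuple k)
    (M : fdmodule (modular_alg k)) : dimvec :=
  ([ffun i => \dim (passmx.leigenspace (fdm_act M (modular_x k)) (tnth w i))],
   [ffun j => \dim (passmx.leigenspace (fdm_act M (modular_y k)) (tnth s j))]).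

Definition euler_form (a b : dimvec) : int :=
  \sum_(i < 3) (a.1 i)%:Z * (b.1 i)%:Z + \sum_(j < 2) (a.2 j)%:Z * (b.2 j)%:Z
  - (\sum_(i < 3) (a.1 i)%:Z) * (\sum_(i < 3) (b.1 i)%:Z).

Record presheaf (k : fieldType) (A : algType k) (d : Order.disp_t)
    (L : porderType d) := Presheaf {
  psh_obj :> L -> fdmodule A;
  psh_res : forall a b : L, (a <= b)%O -> 'Hom(psh_obj b, psh_obj a);
  psh_res_hom : forall a b (ab : (a <= b)%O), amod_hom (psh_res ab);
  psh_res_id : forall a (aa : (a <= a)%O), psh_res aa = \1%VF;
  psh_res_comp : forall a b c
    (ab : (a <= b)%O) (bc : (b <= c)%O) (ac : (a <= c)%O),
    psh_res ac = (psh_res ab \o psh_res bc)%VF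
}.
Arguments psh_res {k A d L} F {a b} ab : rename.

(* The poset 0 <= 1 <= 2 is 'I_3 with its usual order. *)
Section SequencePresheaf.
Variables (k : fieldType) (A : algType k) (W E V : fdmodule A).
Variables (eps : 'Hom(W, E)) (pi : 'Hom(E, V)).
Hypotheses (Heps : amod_hom eps) (Hpi : amod_hom pi).

Definition seq_obj (n : nat) : fdmodule A :=
  match n with 0 => V | 1 => E | _ => W end.

(* Only the values with m <= n matter. *)
Definition seq_res (m n : nat) : 'Hom(seq_obj n, seq_obj m) :=
  match m, n return 'Hom(seq_obj n, seq_obj m) with
  | 0, 0 => \1%VF
  | 0, 1 => pi
  | 0, _.+2 => (pi \o eps)%VF
  | 1, 1 => \1%VF
  | 1, _.+2 => eps
  | _.+2, _.+2 => \1%VF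
  | _, _ => 0
  end.

Fact seq_res_hom m n : amod_hom (seq_res m n).
Proof.
case: m n => [|[|m]] [|[|n]] //=.
- exact: amod_hom1.
- exact: amod_hom_comp.
- exact: amod_hom0.
- exact: amod_hom1.
- exact: amod_hom0.
- exact: amod_hom0.
- exact: amod_hom1.
Qed.

Fact seq_res_id n : seq_res n n = \1%VF.
Proof. by case: n => [|[|n]]. Qed.

Fact seq_res_comp l m n : (l <= m)%N -> (m <= n)%N ->
  seq_res l n = (seq_res l m \o seq_res m n)%VF.
Proof.
by case: l m n => [|[|l]] [|[|m]] [|[|n]] //= _ _;
  rewrite ?comp_lfun1l ?comp_lfun1r.
Qed.

Definition seq_presheaf : presheaf A 'I_3 :=
  @Presheaf k A _ 'I_3 seq_obj (fun a b _ => seq_res a b)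
    (fun a b _ => @seq_res_hom a b) (fun a _ => seq_res_id a)
    (fun a b c ab bc _ => seq_res_comp ab bc).

End SequencePresheaf.

Section Hochschild.
Variables (k : fieldType) (A : algType k) (M N : fdmodule A).

(* A linear map A^{(x) q} -> Hom_k(M, N) is encoded as a q-linear map on
   q-tuples of elements of A.                                            *)
Definition multilinear q (f : {ffun 'I_q -> A} -> 'Hom(M, N)) : Prop :=
  forall (i : 'I_q) (c : k) (u v w : {ffun 'I_q -> A}),
    w i = c *: u i + v i ->
    (forall j, j != i -> w j = u j /\ w j = v j) ->
    f w = c *: f u + f v.

(* (a_0, ..., a_q) |-> (a_0, ..., a_i a_{i+1}, ..., a_q) *)
Definition contract q (i : 'I_q) (x : {ffun 'I_q.+1 -> A}) :
    {ffun 'I_q -> A} :=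
  [ffun j : 'I_q =>
     let xj := x (widen_ord (leqnSn q) j) in let xj1 := x (lift ord0 j) in
     if (j < i)%N then xj else if j == i then xj * xj1 else xj1].

Definition omit q (i : 'I_q.+1) (x : {ffun 'I_q.+1 -> A}) : {ffun 'I_q -> A} :=
  [ffun j => x (lift i j)].

(* The coefficients are the bimodule Hom_k(M, N) with (a f b)(m) = a f(b m). *)
Definition hoch_d q (f : {ffun 'I_q -> A} -> 'Hom(M, N))
    (x : {ffun 'I_q.+1 -> A}) : 'Hom(M, N) :=
  (fdm_act N (x ord0) \o f (omit ord0 x))%VF
  + \sum_(i < q) (-1) ^+ i.+1 *: f (contract i x)
  + (-1) ^+ q.+1 *: (f (omit ord_max x) \o fdm_act M (x ord_max))%VF.

End Hochschild.

Section Chains.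
Variables (d : Order.disp_t) (L : porderType d).

Definition is_chain p (a b : L) (v : {ffun 'I_p.+1 -> L}) : bool :=
  [&& [forall i : 'I_p.+1, forall j : 'I_p.+1, (i <= j)%N ==> (v i <= v j)%O],
      v ord0 == a & v ord_max == b].

(* The chains l_0 <= ... <= l_p, repetitions allowed, with l_0 = a, l_p = b. *)
Definition chain p (a b : L) := {v : {ffun 'I_p.+1 -> L} | is_chain a b v}.

Definition face p (i : 'I_p.+2) (v : {ffun 'I_p.+2 -> L}) :
    {ffun 'I_p.+1 -> L} := [ffun j => v (lift i j)].

Lemma is_chain_le p a b (v : {ffun 'I_p.+1 -> L}) (i j : 'I_p.+1) :
  is_chain a b v -> (i <= j)%N -> (v i <= v j)%O.
Proof. by case/and3P=> /forallP/(_ i)/forallP/(_ j)/implyP H _ _ /H. Qed.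

Lemma is_chain_face p a b (i : 'I_p.+2) (v : {ffun 'I_p.+2 -> L}) :
  is_chain a b v ->
  is_chain (v (lift i ord0)) (v (lift i ord_max)) (face i v).
Proof.
move=> cv; apply/and3P; split; rewrite ?ffunE //.
apply/forallP=> j; apply/forallP=> l; apply/implyP=> jl; rewrite !ffunE.
by apply: (is_chain_le cv); rewrite /= leq_bump2.
Qed.

(* The vertex of index i + 1 of a (p + 1)-chain, for i < p. *)
Definition inner_index p (i : 'I_p) : 'I_p.+2 :=
  lift ord0 (widen_ord (leqnSn p) i).

Section FaceProofs.
Variables (p : nat) (a b : L) (v : {ffun 'I_p.+2 -> L}).
Hypothesis cv : is_chain a b v.

Fact second_le_subproof : (a <= v (lift ord0 ord0))%O.
Proof. by have /and3P[_ /eqP <- _] := cv; apply: (is_chain_le cv). Qed.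

Fact penult_le_subproof : (v (lift ord_max ord_max) <= b)%O.
Proof.
have /and3P[_ _ /eqP <-] := cv; apply: (is_chain_le cv).
by rewrite -ltnS ltn_ord.
Qed.

Fact first_face_subproof : is_chain (v (lift ord0 ord0)) b (face ord0 v).
Proof.
have /and3P[_ _ /eqP <-] := cv.
have -> : (ord_max : 'I_p.+2) = lift ord0 ord_max by apply/val_inj.
exact: is_chain_face cv.
Qed.

Fact last_face_subproof :
  is_chain a (v (lift ord_max ord_max)) (face ord_max v).
Proof.
have /and3P[_ /eqP <- _] := cv.
have -> : (ord0 : 'I_p.+2) = lift ord_max ord0 by apply/val_inj.
exact: is_chain_face cv.
Qed.

Fact inner_face_subproof i : is_chain a b (face (inner_index i) v).
Proof.
have /and3P[_ /eqP va /eqP vb] := cv; have := is_chain_face (inner_index i) cv.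
have <- : (ord0 : 'I_p.+2) = lift (inner_index i) ord0 by apply/val_inj.
have <- : (ord_max : 'I_p.+2) = lift (inner_index i) ord_max.
  by apply/val_inj; rewrite /= /bump /= add1n ltn_ord add1n.
by rewrite va vb.
Qed.

End FaceProofs.

Section Faces.
Variables (p : nat) (a b : L) (c : chain p.+1 a b).

Definition chain_second : L := val c (lift ord0 ord0).
Definition chain_penult : L := val c (lift ord_max ord_max).

Definition chain_second_le : (a <= chain_second)%O :=
  second_le_subproof (valP c).
Definition chain_penult_le : (chain_penult <= b)%O :=
  penult_le_subproof (valP c).

Definition first_face : chain p chain_second b :=
  Sub (face ord0 (val c)) (first_face_subproof (valP c)).
Definition last_face : chain p a chain_penult :=
  Sub (face ord_max (val c)) (last_face_subproof (valP c)).
Definition inner_face (i : 'I_p) : chain p a b :=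
  Sub (face (inner_index i) (val c)) (inner_face_subproof (valP c) i).

End Faces.
End Chains.

Section DoubleComplex.
Variables (k : fieldType) (A : algType k) (d : Order.disp_t) (L : porderType d).
Variables F G : presheaf A L.

(* Families of functions indexed by p-chains; the chains are sorted by their
   endpoints a = l_0 and b = l_p.  K^{p,q} consists of the families all of
   whose members are multilinear.                                          *)
Definition bicochain p q :=
  forall a b : L, chain p a b -> {ffun 'I_q -> A} -> 'Hom(F b, G a).

Definition in_K p q (psi : bicochain p q) : Prop :=
  forall a b (c : chain p a b), multilinear (psi a b c).

Definition K_d p q (psi : bicochain p q) : bicochain p q.+1 :=
  fun a b c => hoch_d (psi a b c).

Definition K_delta p q (psi : bicochain p q) : bicochain p.+1 q :=
  fun a b c x =>
    (psh_res G (chain_second_le c) \o psi _ _ (first_face c) x)%VF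
    + \sum_(i < p) (-1) ^+ i.+1 *: psi a b (inner_face c i) x
    + (-1) ^+ p.+1 *:
        (psi _ _ (last_face c) x \o psh_res F (chain_penult_le c))%VF.

(* Tot^n is the subspace of this product of the families concentrated in
   bidegrees p + q = n, which avoids transporting along p + q = n.        *)
Definition cochains := forall p q, bicochain p q.

HB.instance Definition _ := gen_eqMixin cochains.
HB.instance Definition _ := gen_choiceMixin cochains.

Definition cochains_add (f g : cochains) : cochains :=
  fun p q a b c x => f p q a b c x + g p q a b c x.
Definition cochains_opp (f : cochains) : cochains :=
  fun p q a b c x => - f p q a b c x.
Definition cochains_zero : cochains := fun p q a b c x => 0.
Definition cochains_scale (r : k) (f : cochains) : cochains :=
  fun p q a b c x => r *: f p q a b c x.

Lemma cochainsP (f g : cochains) :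
  (forall p q a b c x, f p q a b c x = g p q a b c x) -> f = g.
Proof.
move=> fg; do 6![apply: functional_extensionality_dep => ?]; exact: fg.
Qed.

Fact cochains_addA : associative cochains_add.
Proof. by move=> f g h; apply: cochainsP => *; apply: addrA. Qed.
Fact cochains_addC : commutative cochains_add.
Proof. by move=> f g; apply: cochainsP => *; apply: addrC. Qed.
Fact cochains_add0 : left_id cochains_zero cochains_add.
Proof. by move=> f; apply: cochainsP => *; apply: add0r. Qed.
Fact cochains_addN : left_inverse cochains_zero cochains_opp cochains_add.
Proof. by move=> f; apply: cochainsP => *; apply: addNr. Qed.
HB.instance Definition _ := GRing.isZmodule.Build cochains
  cochains_addA cochains_addC cochains_add0 cochains_addN.

Fact cochains_scaleA r s f :
  cochains_scale r (cochains_scale s f) = cochains_scale (r * s) f.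
Proof. by apply: cochainsP => *; apply: scalerA. Qed.
Fact cochains_scale1 : left_id 1 cochains_scale.
Proof. by move=> f; apply: cochainsP => *; apply: scale1r. Qed.
Fact cochains_scaleDr : right_distributive cochains_scale +%R.
Proof. by move=> r f g; apply: cochainsP => *; apply: scalerDr. Qed.
Fact cochains_scaleDl f : {morph cochains_scale^~ f : r s / r + s}.
Proof. by move=> r s; apply: cochainsP => *; apply: scalerDl. Qed.
HB.instance Definition _ := GRing.Zmodule_isLmodule.Build k cochains
  cochains_scaleA cochains_scale1 cochains_scaleDr cochains_scaleDl.

Definition Tot (n : nat) (psi : cochains) : Prop :=
  (forall p q, in_K (psi p q)) /\
  (forall p q, (p + q)%N <> n -> psi p q = fun _ _ _ _ => 0).

(* The components in bidegree (p, q) of d psi and of delta psi. *)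
Definition tot_d (psi : cochains) p q : bicochain p q :=
  match q return bicochain p q with
  | 0 => fun _ _ _ _ => 0
  | q'.+1 => K_d (psi p q')
  end.

Definition tot_delta (psi : cochains) p q : bicochain p q :=
  match p return bicochain p q with
  | 0 => fun _ _ _ _ => 0
  | p'.+1 => K_delta (psi p' q)
  end.

Definition tot_diff (psi : cochains) : cochains :=
  fun p q a b c x =>
    tot_d psi c x + (-1) ^+ q *: tot_delta psi c x.

Definition Tot_cocycle n (psi : cochains) : Prop :=
  Tot n psi /\ tot_diff psi = 0.

Definition Tot_coboundary n (psi : cochains) : Prop :=
  match n with
  | 0 => psi = 0
  | m.+1 => exists2 phi, Tot m phi & psi = tot_diff phi
  end.

End DoubleComplex.

(* The quotient Z / B has a k-basis with n elements, B being a subspace of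
   the subspace Z of T.                                                    *)
Definition quotient_dim (k : fieldType) (T : lmodType k) (Z B : T -> Prop)
    (n : nat) : Prop :=
  exists e : 'I_n -> T,
    [/\ forall i, Z (e i),
        forall c : 'I_n -> k, B (\sum_i c i *: e i) -> forall i, c i = 0
      & forall z, Z z -> exists c : 'I_n -> k, B (z - \sum_i c i *: e i)].

Definition ext_dim (k : fieldType) (A : algType k) (d : Order.disp_t)
    (L : porderType d) (F G : presheaf A L) (n m : nat) : Prop :=
  quotient_dim (@Tot_cocycle k A d L F G n) (@Tot_coboundary k A d L F G n) m.

(* Main.v *)
From HB Require Import structures.
Require Import Defs.
From mathcomp Require Import all_boot all_order all_algebra ring.
From mathcomp Require Import boolp finmap.
From mathcomp.multinomials Require Import monalg.

(** Let p be the algebra of the endomorphisms of E that preserve W, that is the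
    u with pi u eps = 0, and for g in A let p^g be the part of p commuting with
    the action of g.  The proof identifies the first extension group of the
    sequence with p / (p^x + p^y) and then counts dimensions.

    A 1-cocycle of the total complex consists of a derivation of A with values
    in the endomorphisms of each of V, E and W, and of a linear map along each
    relation a <= b that measures how far the derivations are from being
    compatible with the sequence (cochain1_cocycleP).  The map from W to V is
    A-linear because pi eps = 0, hence zero as Hom_A(W, V) = 0, and this is exactly what is needed
    to gauge the maps from W to E and from E to V away by one endomorphism of
    E.  What is left is a derivation of A on E with values in p; the other two
    derivations are induced by it.

    A is the group algebra of the free product of a group of order 3 and a
    group of order 2.  A derivation may be prescribed independently on the two
    factors (amalgam_derivation), and it is inner on each of them because 3 and
    2 are invertible (cyclic_potentialP).  After one more gauge transformation
    the derivation kills x and sends y to [y, u] with u in p, and the class of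
    this cocycle vanishes exactly when u lies in p^x + p^y: a Mayer-Vietoris
    argument (bends_up_to_coboundary, bends_coboundary).

    Therefore the dimension is dim p - dim p^x - dim p^y + dim (p^x :&: p^y).
    The last intersection is End_A(E), which is k because the sequence does not
    split (end_extension_scalar).  For g of finite order, a g-equivariant
    splitting of the sequence breaks p^g up into the g-equivariant maps W -> W,
    V -> V and V -> W (dim_parabolic_commutant), and the space of g-equivariant
    maps M -> N has dimension the sum over the eigenvalues of the products of
    the dimensions of the eigenspaces (dim_commutant).  Taking g = 1, x and y
    gives the formula. *)

Set Implicit Arguments.
Unset Strict Implicit.
Unset Printing Implicit Defensive.

Import Order.TTheory GRing.Theory.
Local Open Scope ring_scope.

(** * Derivations with values in linear maps between modules *)

Section Derivations.
Variables (k : fieldType) (A : algType k).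
Implicit Types M N P : fdmodule A.

Lemma fdm_actP M c a b :
  fdm_act M (c *: a + b) = c *: fdm_act M a + fdm_act M b.
Proof. exact: linearP. Qed.

Lemma fdm_act0 M : fdm_act M 0 = 0.
Proof. exact: linear0. Qed.

Definition derivation M N (D : A -> 'Hom(M, N)) : Prop :=
  (forall c a b, D (c *: a + b) = c *: D a + D b) /\
  (forall a b, D (a * b) = ((fdm_act N a \o D b) + (D a \o fdm_act M b))%VF).

Definition inner_der M N (u : 'Hom(M, N)) (a : A) : 'Hom(M, N) :=
  ((fdm_act N a \o u) - (u \o fdm_act M a))%VF.

Lemma inner_derP M N (u : 'Hom(M, N)) : derivation (inner_der u).
Proof.
split=> [c a b|a b]; rewrite /inner_der.
  rewrite !fdm_actP !(comp_lfunDl, comp_lfunDr) -comp_lfunZl -comp_lfunZr.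
  by rewrite scalerBr addrACA -opprD.
rewrite !fdm_actM comp_lfunDr comp_lfunDl comp_lfunNr comp_lfunNl !comp_lfunA.
by rewrite addrA subrK.
Qed.

(** Morphisms of modules are the Hochschild 0-cocycles with coefficients in
    Hom_k(M, N), and inner derivations the 1-coboundaries. *)
Lemma inner_der0P M N (u : 'Hom(M, N)) :
  amod_hom u <-> forall a, inner_der u a = 0.
Proof.
split=> [Hu a|Hu a]; first by rewrite /inner_der -Hu subrr.
by apply/eqP; rewrite eq_sym -subr_eq0; apply/eqP/Hu.
Qed.

Lemma inner_derD M N (u v : 'Hom(M, N)) a :
  inner_der (u + v) a = inner_der u a + inner_der v a.
Proof.
by rewrite /inner_der comp_lfunDr comp_lfunDl opprD addrACA.
Qed.

Lemma inner_derZ M N c (u : 'Hom(M, N)) a :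
  inner_der (c *: u) a = c *: inner_der u a.
Proof. by rewrite /inner_der -comp_lfunZr -comp_lfunZl scalerBr. Qed.

Lemma inner_derN M N (u : 'Hom(M, N)) a :
  inner_der (- u) a = - inner_der u a.
Proof. by rewrite -scaleN1r inner_derZ scaleN1r. Qed.

Lemma inner_derB M N (u v : 'Hom(M, N)) a :
  inner_der (u - v) a = inner_der u a - inner_der v a.
Proof. by rewrite inner_derD inner_derN. Qed.

Lemma inner_der_sum M N n (u : 'I_n -> 'Hom(M, N)) a :
  inner_der (\sum_(i < n) u i) a = \sum_(i < n) inner_der (u i) a.
Proof.
apply: (big_morph (fun v => inner_der v a)) => [v w|]; first exact: inner_derD.
by rewrite /inner_der comp_lfun0l comp_lfun0r subrr.
Qed.

Lemma inner_der_compl M N P (f : 'Hom(N, P)) (u : 'Hom(M, N)) a :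
  amod_hom f -> inner_der (f \o u)%VF a = (f \o inner_der u a)%VF.
Proof.
by move=> Hf; rewrite /inner_der comp_lfunDr comp_lfunNr !comp_lfunA Hf.
Qed.

Lemma inner_der_compr M N P (f : 'Hom(M, N)) (u : 'Hom(N, P)) a :
  amod_hom f -> inner_der (u \o f)%VF a = (inner_der u a \o f)%VF.
Proof.
by move=> Hf; rewrite /inner_der comp_lfunDl comp_lfunNl -!comp_lfunA Hf.
Qed.

Lemma derivation0 M N (D : A -> 'Hom(M, N)) : derivation D -> D 0 = 0.
Proof.
by case=> DL _; have := DL (-1) 0 0; rewrite scaler0 addr0 scaleN1r addNr.
Qed.

Lemma derivation1 M N (D : A -> 'Hom(M, N)) : derivation D -> D 1 = 0.
Proof.
case=> _ DM; have := DM 1 1; rewrite mulr1 !fdm_act1 comp_lfun1l comp_lfun1r.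
by move/eqP; rewrite -subr_eq subrr => /eqP.
Qed.

Lemma derivation_comb M N c (D D' : A -> 'Hom(M, N)) :
  derivation D -> derivation D' -> derivation (fun a => D a + c *: D' a).
Proof.
move=> [DL DM] [DL' DM']; split=> [b x y|x y].
  by rewrite DL DL' !scalerDr !scalerA mulrC addrACA.
rewrite DM DM' scalerDr comp_lfunDr comp_lfunDl addrACA.
by rewrite -comp_lfunZl -comp_lfunZr.
Qed.

Lemma derivation_compl M N P (f : 'Hom(N, P)) (D : A -> 'Hom(M, N)) :
  amod_hom f -> derivation D -> derivation (fun a => f \o D a)%VF.
Proof.
move=> Hf [DL DM]; split=> [c x y|x y].
  by rewrite DL comp_lfunDr -comp_lfunZr.
by rewrite DM comp_lfunDr !comp_lfunA Hf.
Qed.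

Lemma derivation_compr M N P (f : 'Hom(M, N)) (D : A -> 'Hom(N, P)) :
  amod_hom f -> derivation D -> derivation (fun a => D a \o f)%VF.
Proof.
move=> Hf [DL DM]; split=> [c x y|x y].
  by rewrite DL comp_lfunDl -comp_lfunZl.
by rewrite DM comp_lfunDl -!comp_lfunA Hf.
Qed.

End Derivations.

(** * Cocycles and coboundaries of total degree one *)

Section LowDegree.
Variables (k : fieldType) (A : algType k) (d : Order.disp_t) (L : porderType d).
Variable F : presheaf A L.

Lemma chain_le p (a b : L) : chain p a b -> (a <= b)%O.
Proof.
case=> v cv; have /and3P[_ /eqP<- /eqP<-] := cv.
exact: (is_chain_le cv).
Qed.

Lemma chain0_eq (a b : L) : chain 0 a b -> a = b.
Proof.
by case=> v /and3P[_ /eqP<- /eqP<-]; congr (v _); apply/val_inj.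
Qed.

Fact const_chain_subproof p (a : L) : is_chain a a [ffun _ : 'I_p.+1 => a].
Proof.
apply/and3P; split; rewrite ?ffunE //.
by apply/forallP=> i; apply/forallP=> j; rewrite !ffunE lexx implybT.
Qed.
Definition point_chain (a : L) : chain 0 a a := Sub _ (const_chain_subproof 0 a).

Lemma chain0_uniq (a : L) (c : chain 0 a a) : c = point_chain a.
Proof.
apply/val_inj/ffunP=> i; rewrite ffunE.
by case: c => v /= /and3P[_ /eqP va _]; rewrite (ord1 i).
Qed.

Fact edge_chain_subproof (a b : L) : (a <= b)%O ->
  is_chain a b [ffun i : 'I_2 => if i == ord0 then a else b].
Proof.
move=> ab; apply/and3P; split; rewrite ?ffunE //.
apply/forallP=> i; apply/forallP=> j; apply/implyP; rewrite !ffunE.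
by case: i j => [[|[|i]] ?] [[|[|j]] ?].
Qed.
Definition edge_chain (a b : L) (ab : (a <= b)%O) : chain 1 a b :=
  Sub _ (edge_chain_subproof ab).

Lemma chain1_uniq (a b : L) (ab : (a <= b)%O) (c : chain 1 a b) :
  c = edge_chain ab.
Proof.
apply/val_inj/ffunP=> i; rewrite ffunE.
case: c => v /= /and3P[_ /eqP va /eqP vb].
case: ifP => [/eqP->//|/eqP ni0]; rewrite -vb; congr (v _); apply/val_inj.
by case: i ni0 => [[|[|i]] Hi] //= ni0; case: ni0; apply/val_inj.
Qed.

Fact triangle_chain_subproof (a m b : L) : (a <= m)%O -> (m <= b)%O ->
  is_chain a b [ffun i : 'I_3 => if val i == 0%N then a else
                                 if val i == 1%N then m else b].
Proof.
move=> am mb; have ab := le_trans am mb.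
apply/and3P; split; rewrite ?ffunE //.
apply/forallP=> i; apply/forallP=> j; apply/implyP; rewrite !ffunE.
by case: i j => [[|[|[|i]]] ?] [[|[|[|j]]] ?].
Qed.
Definition triangle_chain (a m b : L) (am : (a <= m)%O) (mb : (m <= b)%O) :
  chain 2 a b := Sub _ (triangle_chain_subproof am mb).

Definition edge_data := forall a b : L, (a <= b)%O -> 'Hom(F b, F a).
Definition point_data := forall a : L, A -> 'End(F a).

(** On a 0-chain a = b the restriction map is the identity; composing with it
    gives the cochain its type Hom(F b, F a) without transport along a = b. *)
Definition cochain1 (D : point_data) (phi : edge_data) : cochains F F :=
  fun p q => match p, q return bicochain F F p q with
  | 0, 1 => fun a b c x => (psh_res F (chain_le c) \o D b (x ord0))%VF
  | 1, 0 => fun a b c _ => phi a b (chain_le c)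
  | _, _ => fun _ _ _ _ => 0
  end.

Definition cochain0 (u : forall a, 'End(F a)) : cochains F F :=
  fun p q => match p, q return bicochain F F p q with
  | 0, 0 => fun a b c _ => (psh_res F (chain_le c) \o u b)%VF
  | _, _ => fun _ _ _ _ => 0
  end.

Lemma ffun0_uniq (T : Type) (x y : {ffun 'I_0 -> T}) : x = y.
Proof. by apply/ffunP; case. Qed.

Lemma ffun1E (T : Type) (x : {ffun 'I_1 -> T}) : x = [ffun=> x ord0].
Proof. by apply/ffunP=> i; rewrite ffunE ord1. Qed.

Lemma psh_resE a b (h h' : (a <= b)%O) : psh_res F h = psh_res F h'.
Proof. by rewrite (bool_irrelevance h h'). Qed.

Lemma edge_dataE (phi : edge_data) a b (h h' : (a <= b)%O) :
  phi a b h = phi a b h'.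
Proof. by rewrite (bool_irrelevance h h'). Qed.

Definition linear_data (D : point_data) := forall a c r t,
  D a (c *: r + t) = c *: D a r + D a t.

Lemma Tot0_cochain0 psi : Tot 0 psi -> exists u, psi = cochain0 u.
Proof.
case=> _ psi0; exists (fun a => psi 0 0 a a (point_chain a) [ffun=> 0]).
apply: cochainsP => p q a b c x; case: p q c x => [|p] [|q] c x; last 3 first.
- by rewrite psi0.
- by rewrite psi0.
- by rewrite psi0.
have ab := chain0_eq c; subst b => /=.
by rewrite psh_res_id comp_lfun1l (chain0_uniq c); congr (psi _ _ _ _ _ _);
  apply: ffun0_uniq.
Qed.

Lemma Tot_cochain0 u : Tot 0 (cochain0 u).
Proof.
split=> [p q a b c|[|p] [|q] //].
case: p q c => [|p] [|q] c i r x y z; first by case: i.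
all: by rewrite ?addr0 ?scaler0 ?addr0.
Qed.

(** There is one 0-chain at each point and one 1-chain along each relation,
    repeated vertices included, so these data exhaust total degree one. *)
Lemma Tot1_cochain1 psi : Tot 1 psi ->
  exists D phi, linear_data D /\ psi = cochain1 D phi.
Proof.
case=> psiK psi0.
exists (fun a r => psi 0 1 a a (point_chain a) [ffun=> r]).
exists (fun a b ab => psi 1 0 a b (edge_chain ab) [ffun=> 0]); split.
  move=> a c r t; apply: (psiK 0 1 a a (point_chain a) ord0); rewrite ?ffunE //.
  by move=> j; rewrite (ord1 j).
apply: cochainsP => -[|[|p]] [|[|q]] a b c x /=;
  try by rewrite psi0 // addn1.
- have ab := chain0_eq c; subst b.
  by rewrite psh_res_id comp_lfun1l (chain0_uniq c) -ffun1E.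
- by rewrite -(chain1_uniq (chain_le c) c); congr (psi _ _ _ _ _ _);
    apply: ffun0_uniq.
Qed.

Lemma Tot_cochain1 D phi : linear_data D -> Tot 1 (cochain1 D phi).
Proof.
move=> DL; split=> [p q a b c|[|[|p]] [|[|q]] //].
case: p q c => [|[|p]] [|[|q]] c i r x y z; rewrite ?addr0 ?scaler0 ?addr0 //=.
- by rewrite (ord1 i) => -> _; rewrite DL comp_lfunDr -comp_lfunZr.
- by case: i.
Qed.

Lemma cochain1_comb c D phi D' phi' :
  cochain1 D phi + c *: cochain1 D' phi' =
  cochain1 (fun a r => D a r + c *: D' a r)
           (fun a b ab => phi a b ab + c *: phi' a b ab).
Proof.
apply: cochainsP => -[|[|p]] [|[|q]] a b e x;
  rewrite -[LHS]/(cochain1 _ _ _ _ + c *: cochain1 _ _ _ _) /=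
    ?scaler0 ?addr0 //.
by rewrite comp_lfunDr -comp_lfunZr.
Qed.

(** The vertices of the outer faces of a chain equal its endpoints only
    propositionally; functoriality of the restriction maps absorbs the
    difference, here and in the evaluations of the two outer faces below. *)
Lemma psh_res_natural u a m (am : (a <= m)%O) : a = m ->
  (psh_res F am \o u m = u a \o psh_res F am)%VF.
Proof. by move=> e; subst m; rewrite psh_res_id comp_lfun1l comp_lfun1r. Qed.

Lemma res_second p a b (c : chain p.+1 a b) (u : 'End(F b)) :
  (psh_res F (chain_second_le c)
     \o (psh_res F (chain_le (first_face c)) \o u) =
   psh_res F (chain_le c) \o u)%VF.
Proof. by rewrite comp_lfunA -(psh_res_comp F _ _ (chain_le c)). Qed.

Lemma res_penult a b (c : chain 1 a b) (u : forall m, 'End(F m)) :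
  ((psh_res F (chain_le (last_face c)) \o u (chain_penult c))
     \o psh_res F (chain_penult_le c) =
   u a \o psh_res F (chain_le c))%VF.
Proof.
have e := chain0_eq (last_face c).
by rewrite (psh_res_natural u _ e) -comp_lfunA -(psh_res_comp F _ _ (chain_le c)).
Qed.

Lemma tot_diff_cochain0 u : tot_diff (cochain0 u) =
  cochain1 (fun a => inner_der (u a))
    (fun a b ab => (psh_res F ab \o u b) - (u a \o psh_res F ab))%VF.
Proof.
apply: cochainsP => -[|[|p]] [|[|q]] a b c x; rewrite /tot_diff /tot_d /=
  /K_d /K_delta /hoch_d ?big_ord0 /=
  ?(comp_lfun0l, comp_lfun0r, scaler0, addr0, add0r, expr1, scaleN1r,
    subr0, expr0, scale1r) //.
- have ab := chain0_eq c; subst b.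
  by rewrite psh_res_id !comp_lfun1l (ord1 ord_max).
- by apply: big1 => i _; apply: scaler0.
- by rewrite res_second (res_penult c u).
all: by rewrite !big1 ?(oppr0, scaler0, addr0) // => i _; apply: scaler0.
Qed.

Definition edge_defect (D : point_data) (phi : edge_data) a b
    (ab : (a <= b)%O) r :=
  inner_der (phi a b ab) r - ((psh_res F ab \o D b r) - (D a r \o psh_res F ab))%VF.

Definition triangle_defect (phi : edge_data) a m b (am : (a <= m)%O)
    (mb : (m <= b)%O) (ab : (a <= b)%O) :=
  ((psh_res F am \o phi m b mb) - phi a b ab + (phi a m am \o psh_res F mb))%VF.

(** The three conditions are the components of the differential in bidegrees
    (0, 2), (1, 1) and (2, 0); the remaining components vanish identically. *)
Lemma cochain1_cocycleP D phi : linear_data D ->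
  Tot_cocycle 1 (cochain1 D phi) <->
  [/\ forall a, derivation (D a),
      forall a b (ab : (a <= b)%O) r, edge_defect D phi ab r = 0
    & forall a m b (am : (a <= m)%O) (mb : (m <= b)%O) (ab : (a <= b)%O),
      triangle_defect phi am mb ab = 0].
Proof.
move=> DL.
have E02 a b (c : chain 0 a b) (x : {ffun 'I_2 -> A}) : tot_diff (cochain1 D phi) c x =
    (psh_res F (chain_le c) \o ((fdm_act (F b) (x ord0) \o D b (x ord_max))
       + (D b (x ord0) \o fdm_act (F b) (x ord_max))
       - D b (x ord0 * x ord_max)))%VF :> 'Hom(F b, F a).
  rewrite /tot_diff /tot_d /tot_delta scaler0 addr0 /K_d /hoch_d /=.
  rewrite big_ord_recl big_ord0 addr0 expr1 scaleN1r sqrrN expr1n scale1r.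
  have e := chain0_eq c; subst b; rewrite psh_res_id !comp_lfun1l.
  rewrite !ffunE eqxx (_ : lift ord0 ord0 = ord_max); last exact/val_inj.
  rewrite (_ : widen_ord _ _ = ord0); last exact/val_inj.
  rewrite (_ : lift ord_max ord0 = ord0); last exact/val_inj.
  by rewrite addrAC.
have E11 a b (c : chain 1 a b) (x : {ffun 'I_1 -> A}) :
    tot_diff (cochain1 D phi) c x = edge_defect D phi (chain_le c) (x ord0)
    :> 'Hom(F b, F a).
  rewrite /tot_diff /tot_d /tot_delta /K_d /K_delta /hoch_d /=.
  rewrite !big_ord0 !addr0 !expr1 !scaleN1r res_second.
  rewrite (res_penult c (fun a => D a (x ord0))).
  by rewrite (ord1 ord_max).
have E20 a b (c : chain 2 a b) (x : {ffun 'I_0 -> A}) :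
    tot_diff (cochain1 D phi) c x =
    triangle_defect phi (chain_second_le c) (chain_le (first_face c)) (chain_le c)
    :> 'Hom(F b, F a).
  rewrite /tot_diff /tot_d /tot_delta /K_delta add0r expr0 scale1r.
  rewrite big_ord_recl big_ord0 addr0 expr1 scaleN1r sqrrN expr1n scale1r /=.
  rewrite (edge_dataE phi _ (chain_le c)) /triangle_defect.
  congr (_ + _).
  have : chain_penult c = chain_second c.
    by rewrite /chain_penult /chain_second; congr (val c _); apply/val_inj.
  move: (chain_le (last_face c)) (chain_penult_le c) (chain_second_le c)
    (chain_le (first_face c)); move: (chain_penult c) => m h1 h2 h3 h4 e.
  move: h1 h2; rewrite e => h1 h2.
  by rewrite (psh_resE h2 h4) (edge_dataE phi h1 h3).
split=> [[_ d0]|[Dd De Dt]]; last first.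
  split; first exact: Tot_cochain1.
  apply: cochainsP => -[|[|[|p]]] [|[|[|q]]] a b c x; rewrite ?E11 ?De ?E20 ?Dt //.
  all: rewrite ?E02 ?(Dd _).2 ?subrr ?comp_lfun0r //.
  all: rewrite /tot_diff /tot_d /tot_delta /K_d /K_delta /hoch_d /= ?big_ord0.
  all: rewrite ?big1 ?(comp_lfun0l, comp_lfun0r, oppr0, scaler0, addr0) //.
  all: rewrite ?(comp_lfun0l, comp_lfun0r, scaler0, addr0) //.
  all: try by move=> *; rewrite scaler0.
split=> [a|a b ab r|a m b am mb ab].
- split; first exact: DL.
  move=> r t; pose x := [ffun i : 'I_2 => if i == ord0 then r else t].
  have := E02 a a (point_chain a) x; rewrite d0 => /esym/eqP.
  rewrite psh_res_id comp_lfun1l !ffunE /= subr_eq0 => /eqP /esym.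
  exact.
- have := E11 a b (edge_chain ab) [ffun=> r]; rewrite d0 ffunE => /esym.
  by rewrite (bool_irrelevance (chain_le _) ab).
- have := E20 a b (triangle_chain am mb) [ffun=> 0]; rewrite d0 => /esym.
  have : chain_second (triangle_chain am mb) = m by rewrite /chain_second /= ffunE.
  move: (chain_second_le _) (chain_le _) (chain_le _).
  move: (chain_second _) => m' h1 h2 h3 e; subst m'.
  by rewrite (bool_irrelevance h1 am) (bool_irrelevance h2 ab)
    (bool_irrelevance h3 mb).
Qed.

End LowDegree.

(** * Linear extension from monomials *)

Section LinearExtension.
Variables (k : fieldType) (K : monomType) (U : lmodType k).

Lemma malg_lin_ind (P : {malg k[K]} -> Prop) :
  P 0 -> (forall c m g, P g -> P (c *: << m >> + g)) -> forall g, P g.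
Proof.
move=> P0 PS g; rewrite (monalgE g).
elim: (enum_fset (msupp g)) => [|m l IH]; first by rewrite big_nil.
rewrite big_cons (_ : << g@_m *g m >> = g@_m *: << m >>); first exact: PS.
by apply/malgP=> n; rewrite mcoeffZ !mcoeffU mulrnAr mulr1.
Qed.

Definition lin_ext (h : K -> U) (g : {malg k[K]}) : U :=
  \sum_(m <- msupp g) g@_m *: h m.

Lemma lin_extEw (h : K -> U) (d : {fset K}) g : (msupp g `<=` d)%fset ->
  lin_ext h g = \sum_(m <- d) g@_m *: h m.
Proof.
move=> le; rewrite [LHS](big_fset_incl _ le) => //= x xd /mcoeff_outdom ->.
by rewrite scale0r.
Qed.

Lemma lin_extU (h : K -> U) m : lin_ext h << m >> = h m.
Proof. by rewrite (lin_extEw _ msuppU_le) big_seq_fset1 mcoeffUU scale1r. Qed.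

Lemma lin_ext_is_linear (h : K -> U) : linear (lin_ext h).
Proof.
move=> c g1 g2; pose d := (msupp g1 `|` msupp g2)%fset.
have s1 : (msupp g1 `<=` d)%fset by apply: fsubsetUl.
have s2 : (msupp g2 `<=` d)%fset by apply: fsubsetUr.
have s12 : (msupp (c *: g1 + g2) `<=` d)%fset.
  apply: (fsubset_trans (msuppD_le _ _)).
  by apply: fsetSU; apply: msuppZ_le.
rewrite (lin_extEw _ s1) (lin_extEw _ s2) (lin_extEw _ s12).
rewrite scaler_sumr -big_split /=; apply: eq_bigr => m _.
by rewrite mcoeffD mcoeffZ scalerDl scalerA.
Qed.
HB.instance Definition _ h :=
  GRing.isLinear.Build k {malg k[K]} U *:%R (lin_ext h) (lin_ext_is_linear h).

End LinearExtension.

(** * Derivations of the modular group algebra *)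

Section ModularDerivations.
Variable k : fieldType.
Local Notation A := (modular_alg k).

Definition modular_gen (b : bool) : A :=
  if b then modular_x k else modular_y k.
Definition modular_word (l : seq bool) : A := \prod_(b <- l) modular_gen b.

Lemma modular_pi_linear c (r t : free_alg k) :
  modular_pi (c *: r + t) = c *: modular_pi r + modular_pi t.
Proof. by rewrite modular_piD modular_pi_scale. Qed.

Lemma modular_pi0 : modular_pi (0 : free_alg k) = 0.
Proof. by rewrite -(subrr 0) modular_piB subrr. Qed.

Lemma modular_pi1 : modular_pi (1 : free_alg k) = 1.
Proof. by []. Qed.

Lemma modular_piXn (r : free_alg k) n :
  modular_pi (r ^+ n) = modular_pi r ^+ n.
Proof.
by elim: n => [|n IH]; rewrite ?expr0 // !exprS modular_pi_mul IH.
Qed.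

Lemma malgM_U (m n : {fmonom bool}) :
  << m >> * << n >> = << mmul m n >> :> free_alg k.
Proof. by rewrite malgM_def fgmulUU mulr1. Qed.

Lemma modular_pi_word (m : {fmonom bool}) :
  modular_pi (<< m >> : free_alg k) = modular_word m.
Proof.
case: m => l; elim: l => [|b l IH].
  by rewrite /modular_word /= big_nil -fmoneE.
rewrite /modular_word /= big_cons -[in RHS]/(modular_word l) -IH.
rewrite (_ : FMonom (b :: l) = mmul (fmu b) (FMonom l)).
  by rewrite -malgM_U modular_pi_mul; congr (_ * _); case: b.
by apply/eqP; rewrite fmP fmM fmU.
Qed.

Lemma modular_relation r : modular_relator r -> modular_pi (r : free_alg k) = 0.
Proof.
move=> Rr; rewrite -modular_pi0; apply/modular_piP; rewrite subr0.
by apply/modular_idealP; apply: TSI_gen.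
Qed.

Lemma modular_x3 : modular_x k ^+ 3 = 1.
Proof.
apply/eqP; rewrite -subr_eq0 -modular_piXn -modular_pi1 -modular_piB.
by apply/eqP/modular_relation; left.
Qed.

Lemma modular_y2 : modular_y k ^+ 2 = 1.
Proof.
apply/eqP; rewrite -subr_eq0 -modular_piXn -modular_pi1 -modular_piB.
by apply/eqP/modular_relation; right.
Qed.

Lemma free_alg_scaleAr c (r t : free_alg k) : r * (c *: t) = c *: (r * t).
Proof. by rewrite -!mul_malgC mulrA -free_alg_constC -mulrA. Qed.

Variables M N : fdmodule A.

Lemma derivation_modular_eq0 (D : A -> 'Hom(M, N)) : derivation D ->
  D (modular_x k) = 0 -> D (modular_y k) = 0 -> forall a, D a = 0.
Proof.
move=> Dder Dx Dy a; rewrite -[a]modular_reprK.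
elim/malg_lin_ind: (modular_repr a) => [|c m g IH].
  by rewrite modular_pi0 derivation0.
rewrite modular_pi_linear Dder.1 IH addr0 modular_pi_word.
suff -> : D (modular_word m) = 0 by rewrite scaler0.
elim: (m : seq bool) => [|b l IHl].
  by rewrite /modular_word big_nil derivation1.
rewrite /modular_word big_cons Dder.2 -/(modular_word l) IHl comp_lfun0r add0r.
by case: b; rewrite /= ?Dx ?Dy comp_lfun0l.
Qed.

Lemma amod_hom_modular (f : 'Hom(M, N)) :
  inner_der f (modular_x k) = 0 -> inner_der f (modular_y k) = 0 -> amod_hom f.
Proof.
move=> fx fy; apply/inner_der0P.
exact: (derivation_modular_eq0 (inner_derP f)).
Qed.

(** Given one linear map for each letter, there is a derivation that agrees on
    each letter with the inner derivation of the corresponding map.  It is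
    defined on words by the Leibniz rule, extended linearly to the free algebra,
    and it descends to A because each relation involves a single letter, on
    whose powers the derivation is inner. *)
Section Amalgam.
Variable u : bool -> 'Hom(M, N).

Fixpoint word_der (l : seq bool) : 'Hom(M, N) :=
  if l is b :: l' then
    ((fdm_act N (modular_gen b) \o word_der l')
     + (inner_der (u b) (modular_gen b) \o fdm_act M (modular_word l')))%VF
  else 0.

Lemma modular_word_cat l1 l2 :
  modular_word (l1 ++ l2) = modular_word l1 * modular_word l2.
Proof. by rewrite /modular_word big_cat. Qed.

Lemma word_der_cat l1 l2 : word_der (l1 ++ l2) =
  ((fdm_act N (modular_word l1) \o word_der l2)
   + (word_der l1 \o fdm_act M (modular_word l2)))%VF.
Proof.
elim: l1 => [|b l IH] /=.
  by rewrite /modular_word big_nil fdm_act1 comp_lfun1l comp_lfun0l addr0.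
rewrite IH modular_word_cat fdm_actM comp_lfunDr comp_lfunDl -addrA.
rewrite /modular_word big_cons -/(modular_word l) fdm_actM.
by rewrite !comp_lfunA.
Qed.

Definition free_der : free_alg k -> 'Hom(M, N) :=
  lin_ext (fun m : {fmonom bool} => word_der m).

Lemma free_derP c r t :
  free_der (c *: r + t) = c *: free_der r + free_der t.
Proof. exact: linearP. Qed.

Lemma free_der0 : free_der 0 = 0.
Proof. exact: linear0. Qed.

Lemma free_derB r t : free_der (r - t) = free_der r - free_der t.
Proof. exact: linearB. Qed.

Lemma free_derM r t : free_der (r * t) =
  ((fdm_act N (modular_pi r) \o free_der t)
   + (free_der r \o fdm_act M (modular_pi t)))%VF.
Proof.
elim/malg_lin_ind: r => [|c m r IH].
  by rewrite mul0r modular_pi0 free_der0 fdm_act0 !comp_lfun0l addr0.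
rewrite mulrDl -scalerAl !free_derP IH modular_pi_linear fdm_actP.
rewrite !comp_lfunDl -!comp_lfunZl addrACA -scalerDr; congr (_ *: _ + _).
elim/malg_lin_ind: t {IH} => [|e n t IH].
  by rewrite mulr0 modular_pi0 free_der0 fdm_act0 !comp_lfun0r addr0.
rewrite mulrDr free_alg_scaleAr !free_derP IH modular_pi_linear fdm_actP.
rewrite !comp_lfunDr -!comp_lfunZr addrACA -scalerDr; congr (_ *: _ + _).
by rewrite malgM_U /free_der !lin_extU fmM word_der_cat !modular_pi_word.
Qed.

Lemma free_der_gen b n :
  free_der (<< fmu b >> ^+ n) = inner_der (u b) (modular_gen b ^+ n).
Proof.
have Dn := inner_derP (u b).
have Eb : modular_pi (<< fmu b >> : free_alg k) = modular_gen b by case: (b).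
elim: n => [|n IH].
  by rewrite !expr0 (derivation1 Dn) /free_der lin_extU fm1.
rewrite !exprS free_derM IH Dn.2 modular_piXn Eb; congr (_ + (_ \o _)%VF).
rewrite /free_der lin_extU fmU /= comp_lfun0r add0r /modular_word big_nil.
by rewrite fdm_act1 comp_lfun1r.
Qed.

Lemma free_der_ideal r : r \in @modular_ideal k -> free_der r = 0.
Proof.
have rel b n : modular_gen b ^+ n = 1 -> free_der (<< fmu b >> ^+ n - 1) = 0.
  move=> b1; rewrite -(expr0 (<< fmu b >> : free_alg k)) free_derB !free_der_gen.
  by rewrite b1 expr0 subrr.
move/modular_idealP; elim=> {r} [r [->|->]||r t _ Hr _ Ht|a r b Ir Hr].
- exact: (rel true 3 modular_x3).
- exact: (rel false 2 modular_y2).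
- exact: free_der0.
- by rewrite -(scale1r r) free_derP Hr Ht scaler0 addr0.
- rewrite !free_derM Hr comp_lfun0r add0r modular_pi_mul.
  have -> : modular_pi r = 0.
    by rewrite -modular_pi0; apply/modular_piP; rewrite subr0; apply/modular_idealP.
  by rewrite mulr0 !(fdm_act0, comp_lfun0l, comp_lfun0r, addr0).
Qed.

Lemma amalgam_derivation : exists2 D : A -> 'Hom(M, N), derivation D &
  forall b, D (modular_gen b) = inner_der (u b) (modular_gen b).
Proof.
pose D (a : A) := free_der (modular_repr a).
have Dpi r : D (modular_pi r) = free_der r.
  apply/eqP; rewrite -subr_eq0 /D -free_derB.
  by apply/eqP/free_der_ideal/modular_piP; rewrite modular_reprK.
exists D => [|b].
  split=> [c a b|a b]; rewrite -[a]modular_reprK -[b]modular_reprK.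
    by rewrite -modular_pi_linear !Dpi free_derP.
  by rewrite -modular_pi_mul !Dpi free_derM.
rewrite -[modular_gen b]expr1 -free_der_gen -Dpi; congr D.
by rewrite modular_piXn; case: b.
Qed.

End Amalgam.
End ModularDerivations.

(** On a finite cyclic group of invertible order every derivation is inner: the
    potential is minus the average over the group of the crossed homomorphism
    g^i |-> D(g^i) g^-i, written with g^(n-i) in place of g^-i. *)
Section CyclicPotential.
Variables (k : fieldType) (A : algType k) (M N : fdmodule A).
Variables (D : A -> 'Hom(M, N)) (g : A) (n : nat).

Definition cyclic_potential : 'Hom(M, N) :=
  - (n%:R^-1 *: \sum_(i < n) (D (g ^+ i) \o fdm_act M (g ^+ (n - i)))%VF).

Lemma cyclic_potentialP : derivation D -> g ^+ n = 1 -> n%:R != 0 :> k ->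
  inner_der cyclic_potential g = D g.
Proof.
move=> Dder gn n0; pose S j := (D (g ^+ j) \o fdm_act M (g ^+ (n.+1 - j)))%VF.
rewrite inner_derN inner_derZ.
have -> : inner_der (\sum_(i < n) (D (g ^+ i) \o fdm_act M (g ^+ (n - i)))%VF) g
    = \sum_(i < n) (S i.+1 - S i - D g).
  rewrite inner_der_sum.
  apply: eq_bigr => i _; rewrite /inner_der /S subSS.
  rewrite -comp_lfunA -fdm_actM -exprSr -subSn 1?ltnW //.
  rewrite [g ^+ i.+1]exprS Dder.2 comp_lfunDl -!comp_lfunA -fdm_actM -exprD.
  by rewrite subnKC 1?ltnW // gn fdm_act1 comp_lfun1r addrAC addrK.
(* both ends of the telescope vanish: g ^+ n = 1 = g ^+ 0 and D 1 = 0 *)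
rewrite sumrB sumr_const card_ord -(big_mkord xpredT (fun i => S i.+1 - S i)).
rewrite telescope_sumr // /S gn (derivation1 Dder) !comp_lfun0l.
rewrite subrr sub0r scalerN opprK.
by rewrite -scaler_nat scalerA mulVf ?scale1r.
Qed.
End CyclicPotential.

(** * Eigenspaces of an element of finite order *)

Section EigenIdempotents.
Variables (k : fieldType) (A : algType k) (n : nat) (w : n.-tuple k) (g : A).
Hypotheses (n0 : n%:R != 0 :> k) (uw : uniq w) (w_root : all n.-unity_root w).
Hypothesis gn : g ^+ n = 1.

Lemma tuple_unity_root i : tnth w i ^+ n = 1.
Proof. by apply/unity_rootP/(allP w_root)/mem_tnth. Qed.

(** The idempotents are the Lagrange interpolation polynomials at the n-th roots
    of unity, evaluated at g.  They add up to 1 because the difference has size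
    at most n and n distinct roots. *)
Lemma eigen_idempotents : exists e : 'I_n -> A,
  [/\ forall i, g * e i = tnth w i *: e i, forall i, e i * g = g * e i
    & \sum_i e i = 1].
Proof.
have n_gt0 : (0 < n)%N by case: (n) n0; rewrite ?eqxx.
pose z i : k := tnth w i.
(* Q i is the quotient of 'X^n - 1 by 'X - z i, without using its other roots *)
pose Q i : {poly k} := \sum_(j < n) 'X ^+ (n.-1 - j) * (z i)%:P ^+ j.
have QP i : ('X - (z i)%:P) * Q i = 'X^n - 1.
  by rewrite -subrXX -polyC_exp tuple_unity_root.
have zn0 i : z i != 0.
  apply/eqP=> zi0; have := tuple_unity_root i; rewrite -/(z i) zi0 expr0n.
  by rewrite eqn0Ngt n_gt0 => /eqP; rewrite eq_sym oner_eq0.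
have Qii i : (Q i).[z i] = n%:R * z i ^+ n.-1.
  rewrite horner_sum (eq_bigr (fun=> z i ^+ n.-1)) => [|j _].
    by rewrite sumr_const card_ord mulr_natl.
  rewrite hornerM !horner_exp hornerX hornerC -exprD subnK //.
  by case: (n) j => [|m] [] //.
pose L i := (n%:R * z i ^+ n.-1)^-1 *: Q i.
have Lii i : (L i).[z i] = 1.
  by rewrite hornerZ Qii mulVf // mulf_neq0 ?expf_neq0.
have Lij i j : i != j -> (L i).[z j] = 0.
  move=> ij; rewrite hornerZ; apply/eqP; rewrite mulf_eq0; apply/orP; right.
  have /(congr1 (fun p => p.[z j])) := QP i.
  rewrite hornerM !hornerE tuple_unity_root subrr => /eqP.
  rewrite mulf_eq0 subr_eq0 => /orP[/eqP zij|//].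
  case/negP: ij; apply/eqP; apply: val_inj => /=; apply/eqP.
  rewrite -(nth_uniq 0 _ _ uw) ?size_tuple ?ltn_ord //.
  by rewrite -!tnth_nth -/(z i) -/(z j) zij.
have sumL : \sum_i L i = 1.
  apply/eqP; rewrite -subr_eq0; apply/eqP.
  apply: (roots_geq_poly_eq0 _ uw).
    apply/allP=> y /tnthP[l ->]; rewrite /root -/(z l) hornerD hornerN hornerC.
    rewrite horner_sum (bigD1 l) //= Lii big1 ?addr0 ?subrr // => i il.
    exact: Lij.
  rewrite size_tuple; apply: (leq_trans (size_polyD _ _)); rewrite size_polyN size_poly1 geq_max n_gt0.
  rewrite andbT; apply: (leq_trans (size_sum _ _ _)); apply/bigmax_leqP => i _.
  apply: (leq_trans (size_scale_leq _ _)).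
  apply: (leq_trans (size_sum _ _ _)); apply/bigmax_leqP => j _.
  rewrite -polyC_exp mulrC mul_polyC; apply: (leq_trans (size_scale_leq _ _)).
  by rewrite size_polyXn -[X in (_ < X)%N](prednK n_gt0) ltnS leq_subr.
pose ev := horner_alg g; exists (fun i => ev (L i)); split=> [i|i|].
- apply/eqP; rewrite -subr_eq0 -mulr_algl -mulrBl.
  rewrite -(horner_algX g) -(horner_algC g) -rmorphB /= -rmorphM /=.
  rewrite -scalerAr QP linearZ /= rmorphB rmorphXn rmorph1 /= horner_algX gn.
  by rewrite subrr mulr0.
- by rewrite -(horner_algX g) -!rmorphM mulrC.
- by rewrite -rmorph_sum sumL rmorph1.
Qed.

End EigenIdempotents.

Section Eigenspaces.
Variables (k : fieldType) (A : algType k) (n : nat) (w : n.-tuple k) (g : A).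
Hypotheses (n0 : n%:R != 0 :> k) (uw : uniq w) (w_root : all n.-unity_root w).
Hypothesis gn : g ^+ n = 1.

Definition eigen (M : fdmodule A) i : {vspace M} :=
  passmx.leigenspace (fdm_act M g) (tnth w i).

Lemma eigenP M i v : reflect (fdm_act M g v = tnth w i *: v) (v \in eigen M i).
Proof.
rewrite memv_ker add_lfunE opp_lfunE scale_lfunE id_lfunE subr_eq0.
exact: eqP.
Qed.

Lemma eigen_projections : exists e : 'I_n -> A, forall M : fdmodule A,
  [/\ forall i v, fdm_act M (e i) v \in eigen M i,
      forall i j v, v \in eigen M j ->
        fdm_act M (e i) v = if i == j then v else 0,
      forall i v, fdm_act M (e i) (fdm_act M g v) = tnth w i *: fdm_act M (e i) v
    & forall v, \sum_i fdm_act M (e i) v = v].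
Proof.
have [e [ge eg e1]] := eigen_idempotents n0 uw w_root gn.
exists e => M.
have sum_e v : \sum_i fdm_act M (e i) v = v.
  by rewrite -sum_lfunE -linear_sum e1 fdm_act1 id_lfunE.
have eact i v : fdm_act M (e i) (fdm_act M g v) = tnth w i *: fdm_act M (e i) v.
  by rewrite -comp_lfunE -fdm_actM eg ge linearZ /= scale_lfunE.
have e0 i j v : i != j -> v \in eigen M j -> fdm_act M (e i) v = 0.
  move=> ij /eigenP vj; apply/eqP.
  have : (tnth w i - tnth w j) *: fdm_act M (e i) v == 0.
    have := congr1 (fdm_act M (e i)) vj; rewrite eact linearZ /= => E.
    by rewrite scalerBl E subrr.
  rewrite scaler_eq0 subr_eq0 => /orP[/eqP wij|//].
  case/negP: ij; rewrite -val_eqE -(nth_uniq 0 _ _ uw) ?size_tuple ?ltn_ord //.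
  by rewrite -!tnth_nth wij.
split=> // [i v|i j v vj].
  apply/eigenP; rewrite -comp_lfunE -fdm_actM ge linearZ /=.
  by rewrite scale_lfunE.
have [->|/e0->//] := eqVneq i j.
rewrite -[RHS]sum_e (bigD1 j) //= big1 ?addr0 // => l lj; exact: e0 vj.
Qed.

Lemma dim_eigen_sum (M : fdmodule A) : \sum_i \dim (eigen M i) = \dim {:M}.
Proof.
have [e /(_ M) [eM ee _ e1]] := eigen_projections.
have dir : directv (\sum_i eigen M i).
  apply/directv_sum_independent => u uM u0 i _.
  have := congr1 (fdm_act M (e i)) u0; rewrite linear0 linear_sum (bigD1 i) //=.
  rewrite (ee _ _ _ (uM i isT)) eqxx big1 ?addr0 // => j ji.
  by rewrite (ee _ _ _ (uM j isT)) eq_sym (negPf ji).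
rewrite -(directvP dir) /=; congr (\dim _); apply/eqP; rewrite eqEsubv subvf /=.
apply/subvP=> v _; rewrite -(e1 v); apply: memv_suml => i _.
by apply: (subvP (sumv_sup i _ _)) (eM i v).
Qed.

End Eigenspaces.

(** * Equivariant linear maps *)

Section Corner.
Variables (k : fieldType) (aT rT : vectType k).
Variables (U : {vspace aT}) (W : {vspace rT}) (p : 'End(aT)).
Hypotheses (pU : forall v, p v \in U) (pid : {in U, forall v, p v = v}).

Definition extend_corner (h : 'Hom(subvs_of U, subvs_of W)) : 'Hom(aT, rT) :=
  (linfun vsval \o h \o linfun (vsproj U) \o p)%VF.

Lemma extend_corner_is_linear : linear extend_corner.
Proof.
move=> c h h'; rewrite /extend_corner comp_lfunDr !comp_lfunDl.
by rewrite -comp_lfunZr -!comp_lfunZl.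
Qed.
HB.instance Definition _ := GRing.isLinear.Build k 'Hom(subvs_of U, subvs_of W)
  'Hom(aT, rT) *:%R extend_corner extend_corner_is_linear.

(** Encoded as the image of Hom(U, W) under extension by zero along p, an
    injective map, so that the dimension can be read off. *)
Definition hom_corner : {vspace 'Hom(aT, rT)} := limg (linfun extend_corner).

Lemma hom_cornerP T :
  T \in hom_corner <-> ((T \o p)%VF = T /\ forall v, T v \in W).
Proof.
split=> [/memv_imgP[h _ ->]|[Tp TW]].
  rewrite lfunE /= /extend_corner; split=> [|v].
    by apply/lfunP=> v; rewrite !comp_lfunE (pid (pU v)).
  by rewrite !comp_lfunE lfunE /= subvsP.
pose h : 'Hom(subvs_of U, subvs_of W) :=
  (linfun (vsproj W) \o T \o linfun vsval)%VF.
suff -> : T = linfun extend_corner h by apply: memv_img (memvf _).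
apply/lfunP=> v; rewrite lfunE /= /extend_corner !comp_lfunE !lfunE /=.
by rewrite vsprojK // vsprojK // -[in LHS]Tp comp_lfunE.
Qed.

Lemma dim_hom_corner : \dim hom_corner = (\dim U * \dim W)%N.
Proof.
rewrite limg_dim_eq ?dimvf //.
apply/eqP; rewrite capfv; apply/lker0P => h h'.
rewrite !lfunE /= => hh; apply/lfunP => v; apply: val_inj => /=.
have := congr1 (fun f : 'Hom(aT, rT) => f (vsval v)) hh.
by rewrite /extend_corner !comp_lfunE !lfunE /= (pid (subvsP v)) vsvalK.
Qed.

End Corner.

Section Commutant.
Variables (k : fieldType) (A : algType k).
Implicit Types M N : fdmodule A.

Lemma inner_der_is_linear M N a : linear ((@inner_der k A M N)^~ a).
Proof. by move=> c u v; rewrite inner_derD inner_derZ. Qed.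

(** The inner derivation as a function of its potential, in the argument order
    that carries the linear structure. *)
Definition ad_at M N a (u : 'Hom(M, N)) := inner_der u a.
HB.instance Definition _ M N a := GRing.isLinear.Build k 'Hom(M, N) 'Hom(M, N)
  *:%R (@ad_at M N a) (@inner_der_is_linear M N a).

Definition commutant M N a : {vspace 'Hom(M, N)} := lker (linfun (@ad_at M N a)).

Lemma commutantP M N a u :
  reflect (inner_der u a = 0) (u \in commutant M N a).
Proof. by rewrite memv_ker lfunE; apply: eqP. Qed.

Lemma commutantE M N a (u : 'Hom(M, N)) : u \in commutant M N a ->
  forall v, fdm_act N a (u v) = u (fdm_act M a v).
Proof.
move=> /commutantP/eqP; rewrite subr_eq0 => /eqP/lfunP uv v.
by have := uv v; rewrite !comp_lfunE.
Qed.

(** An equivariant map is block diagonal for the eigenspaces of g, so the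
    commutant is the direct sum of the corners of equal eigenvalue. *)
Lemma dim_commutant n (w : n.-tuple k) (g : A) M N :
  n%:R != 0 :> k -> uniq w -> all n.-unity_root w -> g ^+ n = 1 ->
  \dim (commutant M N g) =
  (\sum_i \dim (eigen w g M i) * \dim (eigen w g N i))%N.
Proof.
move=> n0 uw w_root gn.
have [e eP] := eigen_projections n0 uw w_root gn.
have [eM eeM egM e1M] := eP M.
pose S i := hom_corner (eigen w g M i) (eigen w g N i) (fdm_act M (e i)).
have pid i : {in eigen w g M i, forall v, fdm_act M (e i) v = v}.
  by move=> v vi; rewrite (eeM i i v vi) eqxx.
have SP i T := hom_cornerP (eigen w g N i) (eM i) (pid i) T.
have dir : directv (\sum_i S i).
  apply/directv_sum_independent => T TS T0 j _; apply/lfunP => v.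
  have := congr1 (fun f : 'Hom(M, N) => f (fdm_act M (e j) v)) T0.
  rewrite /= zero_lfunE sum_lfunE (bigD1 j) //= big1 ?addr0 => [E|i ij].
    rewrite zero_lfunE -E.
    by have [Tj _] := (SP j (T j)).1 (TS j isT); rewrite -{1}Tj comp_lfunE.
  have [<- _] := (SP i (T i)).1 (TS i isT).
  by rewrite comp_lfunE (eeM i j _ (eM j v)) (negPf ij) linear0.
rewrite (eq_bigr (fun i => \dim (S i))) => [|i _]; last first.
  by rewrite (dim_hom_corner _ (pid i)).
rewrite -(directvP dir) /=; congr (\dim _); apply/eqP; rewrite eqEsubv.
apply/andP; split; apply/subvP => T.
  move=> /commutantE gT.
  have -> : T = \sum_i (T \o fdm_act M (e i))%VF.
    apply/lfunP=> v; rewrite sum_lfunE -{1}(e1M v) linear_sum.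
    by apply: eq_bigr => i _; rewrite comp_lfunE.
  apply: memv_suml => i _; apply: (subvP (sumv_sup i _ _)) => //; apply/SP.
  split=> [|v]; first by apply/lfunP=> v; rewrite !comp_lfunE (pid i _ (eM i _)).
  apply/eigenP; rewrite comp_lfunE gT.
  by have /eigenP -> := eM i v; rewrite linearZ.
move=> /memv_sumP[Ts TsS ->]; apply: memv_suml => i _.
have [Ti TN] := (SP i _).1 (TsS i isT).
apply/commutantP/eqP; rewrite subr_eq0; apply/eqP/lfunP => v; rewrite !comp_lfunE.
have /eigenP -> := TN v.
by rewrite -Ti !comp_lfunE egM linearZ.
Qed.
End Commutant.

(** * The parabolic algebra of an extension *)

Section Sandwich.
Variables (k : fieldType) (U V W X : vectType k).

Definition sandwich (f : 'Hom(W, X)) (h : 'Hom(U, V)) (u : 'Hom(V, W)) :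
  'Hom(U, X) := (f \o u \o h)%VF.

Lemma sandwich_is_linear f h : linear (sandwich f h).
Proof.
move=> c u v; rewrite /sandwich comp_lfunDr comp_lfunDl.
by rewrite -comp_lfunZr -comp_lfunZl.
Qed.
HB.instance Definition _ f h := GRing.isLinear.Build k 'Hom(V, W) 'Hom(U, X)
  *:%R (sandwich f h) (sandwich_is_linear f h).

Lemma sandwich_kerP f h u :
  reflect ((f \o u \o h)%VF = 0) (u \in lker (linfun (sandwich f h))).
Proof. by rewrite memv_ker lfunE; apply: eqP. Qed.

End Sandwich.

Section Extension.
Variables (k : fieldType) (A : algType k) (W E V : fdmodule A).
Variables (eps : 'Hom(W, E)) (pi : 'Hom(E, V)).
Hypotheses (Heps : amod_hom eps) (Hpi : amod_hom pi).
Hypothesis exact_F : short_exact eps pi.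

Lemma pi_eps : (pi \o eps)%VF = 0.
Proof.
have [_ im_eps _] := exact_F; apply/lfunP=> v; rewrite comp_lfunE zero_lfunE.
by apply/eqP; rewrite -memv_ker -im_eps memv_img ?memvf.
Qed.

Lemma linear_splitting : exists (r : 'Hom(E, W)) (s : 'Hom(V, E)),
  [/\ (r \o eps)%VF = \1%VF, (pi \o s)%VF = \1%VF
    & ((eps \o r) + (s \o pi))%VF = \1%VF].
Proof.
have [ker_eps im_eps im_pi] := exact_F.
have eps_inj : lker eps == 0%VS by rewrite ker_eps.
have pis : (pi \o pi^-1)%VF = \1%VF.
  apply/lfunP=> v; rewrite comp_lfunE id_lfunE.
  by rewrite limg_lfunVK // im_pi memvf.
exists (eps^-1 \o (\1 - (pi^-1 \o pi)))%VF, (pi^-1)%VF; split=> //.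
  rewrite -comp_lfunA comp_lfunDl comp_lfunNl -comp_lfunA pi_eps.
  by rewrite comp_lfun0r subr0 comp_lfun1l lker0_compVf.
apply/lfunP=> v; rewrite add_lfunE !comp_lfunE id_lfunE limg_lfunVK.
  by rewrite add_lfunE opp_lfunE id_lfunE comp_lfunE subrK.
rewrite im_eps memv_ker add_lfunE opp_lfunE id_lfunE linearB /= comp_lfunE.
by rewrite -[pi (pi^-1%VF _)]comp_lfunE pis id_lfunE subrr.
Qed.

Lemma eps_cancel (U : vectType k) (f h : 'Hom(U, W)) :
  (eps \o f = eps \o h)%VF -> f = h.
Proof.
have [r [s [re _ _]]] := linear_splitting => /(congr1 (comp_lfun r)).
by rewrite !comp_lfunA re !comp_lfun1l.
Qed.

Lemma pi_cancel (U : vectType k) (f h : 'Hom(V, U)) :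
  (f \o pi = h \o pi)%VF -> f = h.
Proof.
have [r [s [_ ps _]]] := linear_splitting => /(congr1 (fun l => l \o s)%VF).
by rewrite -!comp_lfunA ps !comp_lfun1r.
Qed.

Lemma eps_factor (U : vectType k) (f : 'Hom(U, E)) :
  (pi \o f)%VF = 0 -> exists t : 'Hom(U, W), f = (eps \o t)%VF.
Proof.
have [r [s [_ _ one]]] := linear_splitting => pf.
exists (r \o f)%VF; rewrite -{1}(comp_lfun1l f) -one comp_lfunDl -!comp_lfunA pf.
by rewrite comp_lfun0r addr0.
Qed.

Lemma pi_factor (U : vectType k) (f : 'Hom(E, U)) :
  (f \o eps)%VF = 0 -> exists t : 'Hom(V, U), f = (t \o pi)%VF.
Proof.
have [r [s [_ _ one]]] := linear_splitting => fe.
exists (f \o s)%VF; rewrite -{1}(comp_lfun1r f) -one comp_lfunDr !comp_lfunA fe.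
by rewrite comp_lfun0l add0r.
Qed.

(** A linear section s0 of pi becomes g-equivariant after subtracting the
    averaged potential of the inner derivation of s0.  The correction is killed
    by pi, as pi s0 = 1 commutes with everything, so the result is still a
    section; the retraction of eps is then forced. *)
Lemma equivariant_splitting (g : A) n : n%:R != 0 :> k -> g ^+ n = 1 ->
  exists (r : 'Hom(E, W)) (s : 'Hom(V, E)),
  [/\ (r \o eps)%VF = \1%VF, (pi \o s)%VF = \1%VF,
      ((eps \o r) + (s \o pi))%VF = \1%VF,
      inner_der r g = 0 & inner_der s g = 0].
Proof.
move=> n0 gn; have [_ [s0 [_ ps0 _]]] := linear_splitting.
pose s := s0 - cyclic_potential (inner_der s0) g n.
have gs : inner_der s g = 0.
  by rewrite inner_derB cyclic_potentialP ?subrr //; apply: inner_derP.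
have ps : (pi \o s)%VF = \1%VF.
  rewrite comp_lfunDr ps0 comp_lfunNr comp_lfunNr opprK -comp_lfunZr.
  rewrite (_ : (pi \o _)%VF = 0) ?scaler0 ?addr0 //.
  have pi0 (a b : A) : (pi \o (inner_der s0 a \o fdm_act V b))%VF = 0.
    rewrite comp_lfunA -inner_der_compl // ps0 (_ : inner_der _ _ = 0).
      by rewrite comp_lfun0l.
    exact: (inner_der0P _).1 (@amod_hom1 _ _ V) a.
  by elim/big_ind: _ => [|u v Hu Hv|i _];
    rewrite ?comp_lfun0r ?comp_lfunDr ?Hu ?Hv ?addr0.
have [r Er] : exists r, (\1 - (s \o pi))%VF = (eps \o r)%VF.
  by apply: eps_factor; rewrite comp_lfunDr comp_lfunNr comp_lfunA ps
    comp_lfun1l comp_lfun1r subrr.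
exists r, s; split=> //.
- apply: eps_cancel; rewrite comp_lfunA -Er comp_lfunDl comp_lfunNl -comp_lfunA.
  by rewrite pi_eps comp_lfun0r subr0 comp_lfun1l comp_lfun1r.
- by rewrite -Er subrK.
- apply: eps_cancel; rewrite -inner_der_compl // -Er inner_derB.
  rewrite (inner_der_compr _ _ Hpi) gs comp_lfun0l comp_lfun0r subr0.
  exact: (inner_der0P _).1 (@amod_hom1 _ _ E) g.
Qed.

Definition parabolic : {vspace 'End(E)} := lker (linfun (sandwich pi eps)).

Lemma parabolicP u : reflect ((pi \o u \o eps)%VF = 0) (u \in parabolic).
Proof. exact: sandwich_kerP. Qed.

Lemma commutant_comp (M N P : fdmodule A) (g : A) (f : 'Hom(N, P)) (h : 'Hom(M, N)) :
  inner_der f g = 0 -> inner_der h g = 0 -> inner_der (f \o h)%VF g = 0.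
Proof.
rewrite /inner_der => /eqP; rewrite subr_eq0 => /eqP fg /eqP.
rewrite subr_eq0 => /eqP hg; apply/eqP; rewrite subr_eq0; apply/eqP.
by rewrite comp_lfunA fg -comp_lfunA hg comp_lfunA.
Qed.

(** With respect to an equivariant splitting, an element of the parabolic is a
    block triangular matrix with blocks W -> W, V -> V and V -> W.  The blocks are
    split off one at a time, each by rank-nullity for the map extracting it. *)
Lemma dim_parabolic_commutant (g : A) n : n%:R != 0 :> k -> g ^+ n = 1 ->
  \dim (parabolic :&: commutant E E g) =
  (\dim (commutant W W g) + \dim (commutant V V g) + \dim (commutant V W g))%N.
Proof.
move=> n0 gn; have [r [s [re ps one gr gs]]] := equivariant_splitting n0 gn.
have ge : inner_der eps g = 0 by apply: (inner_der0P _).1.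
have gp : inner_der pi g = 0 by apply: (inner_der0P _).1.
have rs : (r \o s)%VF = 0.
  apply: eps_cancel; rewrite comp_lfunA -[(eps \o r)%VF](addrK (s \o pi)%VF) one.
  by rewrite comp_lfunDl comp_lfunNl -comp_lfunA ps comp_lfun1l comp_lfun1r
    subrr comp_lfun0r.
pose fW := linfun (sandwich r eps); pose fV := linfun (sandwich pi s).
pose fH := linfun (sandwich r s).
pose K0 := (parabolic :&: commutant E E g)%VS.
pose K1 := (K0 :&: lker fW)%VS; pose K2 := (K1 :&: lker fV)%VS.
have K0P u : reflect ((pi \o u \o eps)%VF = 0 /\ inner_der u g = 0) (u \in K0).
  by rewrite memv_cap; apply: (iffP andP) => -[/parabolicP ? /commutantP ?].
have EW : (fW @: K0)%VS = commutant W W g.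
  apply/eqP; rewrite eqEsubv; apply/andP; split; apply/subvP=> u.
    move=> /memv_imgP[v /K0P[_ vg] ->]; rewrite lfunE; apply/commutantP.
    by apply: commutant_comp => //; apply: commutant_comp.
  move=> /commutantP ug; have -> : u = fW (eps \o u \o r)%VF.
    by rewrite lfunE /= /sandwich !comp_lfunA re comp_lfun1l -comp_lfunA re comp_lfun1r.
  apply: memv_img; apply/K0P; split; last by apply: commutant_comp => //; apply: commutant_comp.
  by rewrite !comp_lfunA pi_eps !comp_lfun0l.
have EV : (fV @: K1)%VS = commutant V V g.
  apply/eqP; rewrite eqEsubv; apply/andP; split; apply/subvP=> u.
    move=> /memv_imgP[v /memv_capP[/K0P[_ vg] _] ->].
    by rewrite lfunE; apply/commutantP; apply: commutant_comp => //; apply: commutant_comp.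
  move=> /commutantP ug; have -> : u = fV (s \o u \o pi)%VF.
    by rewrite lfunE /= /sandwich !comp_lfunA ps comp_lfun1l -comp_lfunA ps comp_lfun1r.
  apply: memv_img; apply/memv_capP; split.
    apply/K0P; split; last by apply: commutant_comp => //; apply: commutant_comp.
    by rewrite -!comp_lfunA pi_eps !comp_lfun0r.
  by apply/sandwich_kerP; rewrite -!comp_lfunA pi_eps !comp_lfun0r.
have EH : (fH @: K2)%VS = commutant V W g.
  apply/eqP; rewrite eqEsubv; apply/andP; split; apply/subvP=> u.
    move=> /memv_imgP[v /memv_capP[/memv_capP[/K0P[_ vg] _] _] ->].
    by rewrite lfunE; apply/commutantP; apply: commutant_comp => //; apply: commutant_comp.
  move=> /commutantP ug; have -> : u = fH (eps \o u \o pi)%VF.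
    by rewrite lfunE /= /sandwich !comp_lfunA re comp_lfun1l -comp_lfunA ps comp_lfun1r.
  apply: memv_img; apply/memv_capP; split; last first.
    by apply/sandwich_kerP; rewrite !comp_lfunA pi_eps !comp_lfun0l.
  apply/memv_capP; split; last first.
    by apply/sandwich_kerP; rewrite -!comp_lfunA pi_eps !comp_lfun0r.
  apply/K0P; split; last by apply: commutant_comp => //; apply: commutant_comp.
  by rewrite !comp_lfunA pi_eps !comp_lfun0l.
have K3 : (K2 :&: lker fH)%VS = 0%VS.
  apply/eqP; rewrite -subv0; apply/subvP=> u.
  move=> /memv_capP[/memv_capP[/memv_capP[/K0P[u1 _] /sandwich_kerP u2]
                   /sandwich_kerP u3] /sandwich_kerP u4].
  have joint (U : vectType k) (f : 'Hom(U, E)) : (r \o f = 0)%VF ->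
      (pi \o f = 0)%VF -> f = 0.
    move=> rf pf; rewrite -(comp_lfun1l f) -one comp_lfunDl -!comp_lfunA rf pf.
    by rewrite !comp_lfun0r addr0.
  have ue : (u \o eps)%VF = 0 by apply: joint; rewrite comp_lfunA.
  have us : (u \o s)%VF = 0 by apply: joint; rewrite comp_lfunA.
  by rewrite memv0 -(comp_lfun1r u) -one comp_lfunDr !comp_lfunA ue us
    !comp_lfun0l addr0.
rewrite -EW -EV -EH -/K0 -(limg_ker_dim fW K0) -/K1 -(limg_ker_dim fV K1) -/K2.
by rewrite -(limg_ker_dim fH K2) K3 dimv0 add0n addnC addnA addnAC.
Qed.

Lemma dim_parabolic_eigen (g : A) n (w : n.-tuple k) :
  n%:R != 0 :> k -> uniq w -> all n.-unity_root w -> g ^+ n = 1 ->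
  \dim (parabolic :&: commutant E E g) =
  (\sum_i \dim (eigen w g W i) * \dim (eigen w g W i)
   + \sum_i \dim (eigen w g V i) * \dim (eigen w g V i)
   + \sum_i \dim (eigen w g V i) * \dim (eigen w g W i))%N.
Proof.
move=> n0 uw w_root gn.
by rewrite (dim_parabolic_commutant n0 gn) !(dim_commutant _ _ n0 uw w_root gn).
Qed.

Lemma amod_hom_eps (U : fdmodule A) (f : 'Hom(U, W)) :
  amod_hom (eps \o f)%VF -> amod_hom f.
Proof.
move=> /inner_der0P ef; apply/inner_der0P => a; apply: eps_cancel.
by rewrite -inner_der_compl // ef comp_lfun0r.
Qed.

Lemma amod_hom_pi (U : fdmodule A) (f : 'Hom(V, U)) :
  amod_hom (f \o pi)%VF -> amod_hom f.
Proof.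
move=> /inner_der0P fp; apply/inner_der0P => a; apply: pi_cancel.
by rewrite -inner_der_compr // fp comp_lfun0l.
Qed.

Lemma derivation_eps (U : fdmodule A) (D : A -> 'Hom(U, W)) :
  derivation (fun a => eps \o D a)%VF -> derivation D.
Proof.
move=> [DL DM]; split=> [c a b|a b]; apply: eps_cancel.
  by rewrite DL comp_lfunDr -comp_lfunZr.
by rewrite DM comp_lfunDr !comp_lfunA Heps.
Qed.

Lemma derivation_pi (U : fdmodule A) (D : A -> 'Hom(V, U)) :
  derivation (fun a => D a \o pi)%VF -> derivation D.
Proof.
move=> [DL DM]; split=> [c a b|a b]; apply: pi_cancel.
  by rewrite DL comp_lfunDl -comp_lfunZl.
by rewrite DM comp_lfunDl -!comp_lfunA Hpi.
Qed.

Lemma amod_homZ (M N : fdmodule A) c (u : 'Hom(M, N)) :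
  amod_hom u -> amod_hom (c *: u).
Proof.
by move=> /inner_der0P u0; apply/inner_der0P => a; rewrite inner_derZ u0 scaler0.
Qed.

Lemma amod_homB (M N : fdmodule A) (u v : 'Hom(M, N)) :
  amod_hom u -> amod_hom v -> amod_hom (u - v).
Proof.
move=> /inner_der0P u0 /inner_der0P v0; apply/inner_der0P => a.
by rewrite inner_derB u0 v0 subrr.
Qed.

Lemma end_iso_scalar (M : fdmodule A) (g : 'End(M)) :
  end_iso_base M -> amod_hom g -> exists c, g = c *: \1%VF.
Proof.
move=> [f [f1 _ _ fP]] /fP[c <-]; exists c.
by rewrite -f1 -linearZ; congr (f _); rewrite -[RHS]/(c * 1) mulr1.
Qed.

Lemma end_iso_neq0 (M : fdmodule A) :
  end_iso_base M -> \1%VF != 0 :> 'End(M).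
Proof.
move=> [f [f1 _ finj _]]; rewrite -f1 -(linear0 f) (inj_eq finj).
exact: oner_neq0.
Qed.

Lemma parabolic_restrict u : u \in parabolic ->
  exists uW uV, (eps \o uW = u \o eps)%VF /\ (pi \o u = uV \o pi)%VF.
Proof.
move=> /parabolicP u0.
have [uW uWP] : exists uW, (u \o eps)%VF = (eps \o uW)%VF.
  by apply: eps_factor; rewrite comp_lfunA.
have [uV uVP] : exists uV, (pi \o u)%VF = (uV \o pi)%VF by exact: pi_factor.
by exists uW, uV.
Qed.

Hypotheses (nonsplit_F : ~ split_epi pi).
Hypotheses (hom_VW : hom_zero V W) (hom_WV : hom_zero W V).
Hypotheses (end_V : end_iso_base V) (end_W : end_iso_base W).

Lemma amod_hom_parabolic (u : 'End(E)) : amod_hom u -> u \in parabolic.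
Proof.
by move=> Hu; apply/parabolicP/hom_WV; do !apply: amod_hom_comp.
Qed.

(** The section is obtained from the complementary idempotent 1 - eps r, which
    factors through pi. *)
Lemma retraction_split (r : 'Hom(E, W)) :
  amod_hom r -> (r \o eps)%VF = \1%VF -> split_epi pi.
Proof.
move=> Hr re.
have [s sP] : exists s, (\1 - (eps \o r))%VF = (s \o pi)%VF.
  apply: pi_factor; rewrite comp_lfunDl comp_lfunNl -comp_lfunA re.
  by rewrite comp_lfun1l comp_lfun1r subrr.
exists s.
  apply: amod_hom_pi; rewrite -sP; apply: amod_homB; first exact: amod_hom1.
  exact: amod_hom_comp.
apply: pi_cancel; rewrite -comp_lfunA -sP comp_lfunDr comp_lfunNr comp_lfunA.
by rewrite pi_eps comp_lfun0l subr0 comp_lfun1l comp_lfun1r.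
Qed.

(** An endomorphism u preserves W, acting there by a scalar a and on V by a
    scalar b.  The difference u - b factors as eps t with t eps = a - b.  If a and
    b differed, a multiple of t would split the sequence; hence t factors
    through a morphism from V to W, which is zero. *)
Lemma end_extension_scalar (u : 'End(E)) :
  amod_hom u -> exists c, u = c *: \1%VF.
Proof.
move=> Hu; have [uW [uV [uWP uVP]]] := parabolic_restrict (amod_hom_parabolic Hu).
have [a aP] : exists a, uW = a *: \1%VF.
  by apply: (end_iso_scalar end_W); apply: amod_hom_eps; rewrite uWP;
    apply: amod_hom_comp.
have [b bP] : exists b, uV = b *: \1%VF.
  by apply: (end_iso_scalar end_V); apply: amod_hom_pi; rewrite -uVP;
    apply: amod_hom_comp.
pose v : 'End(E) := u - b *: \1%VF.
have Hv : amod_hom v by apply/(amod_homB Hu)/amod_homZ/amod_hom1.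
have [t tP] : exists t, v = (eps \o t)%VF.
  apply: eps_factor; rewrite comp_lfunDr comp_lfunNr uVP bP.
  by rewrite -comp_lfunZl -comp_lfunZr comp_lfun1l comp_lfun1r subrr.
have Ht : amod_hom t by apply: amod_hom_eps; rewrite -tP.
have te : (t \o eps)%VF = (a - b) *: \1%VF.
  apply: eps_cancel; rewrite comp_lfunA -tP comp_lfunDl comp_lfunNl -uWP aP.
  by rewrite -comp_lfunZl -!comp_lfunZr comp_lfun1l comp_lfun1r scalerBl.
have [ab|ab] := eqVneq a b; last first.
  case: nonsplit_F; apply: (@retraction_split ((a - b)^-1 *: t)).
    exact: amod_homZ.
  by rewrite -comp_lfunZl te scalerA mulVf ?subr_eq0 // scale1r.
have [t' t'P] : exists t', t = (t' \o pi)%VF.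
  by apply: pi_factor; rewrite te ab subrr scale0r.
have Ht' : amod_hom t' by apply: amod_hom_pi; rewrite -t'P.
exists b; apply/eqP; rewrite -subr_eq0 -/v tP t'P (hom_VW Ht').
by rewrite comp_lfun0l comp_lfun0r.
Qed.

Lemma end_extension_neq0 : \1%VF != 0 :> 'End(E).
Proof.
apply/eqP=> one0; have /eqP[] := end_iso_neq0 end_V.
apply: pi_cancel; rewrite comp_lfun1l comp_lfun0l -(comp_lfun1r pi) one0.
by rewrite comp_lfun0r.
Qed.

End Extension.

(** * Dimension of a subquotient through a linear correspondence *)

(** The relation R plays the role of an isomorphism from P / Q to Z / B that is
    only defined up to choices of representatives on both sides. *)
Lemma quotient_dim_correspondence (k : fieldType) (U : vectType k)
    (T : lmodType k) (P Q : {vspace U}) (R : T -> U -> Prop) (Z B : T -> Prop) :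
  (Q <= P)%VS ->
  (forall z z', B z -> B z' -> B (z + z')) ->
  (forall c z z' u u', R z u -> R z' u' -> R (z + c *: z') (u + c *: u')) ->
  R 0 0 ->
  (forall z u, R z u -> Z z) ->
  (forall u, u \in P -> exists z, R z u) ->
  (forall z, Z z -> exists z' u, [/\ u \in P, R z' u & B (z - z')]) ->
  (forall z u, R z u -> u \in P -> B z <-> u \in Q) ->
  quotient_dim Z B (\dim (P :\: Q)%VS).
Proof.
move=> QP BD RD R0 RZ exR surR RB; set C := (P :\: Q)%VS.
have CP : (C <= P)%VS by apply: diffvSl.
have /choice[e eR] (i : 'I_(\dim C)) : exists z, R z (vbasis C)`_i.
  apply: exR; apply: (subvP CP); apply: vbasis_mem.
  by apply: mem_nth; rewrite size_tuple.
have Rsum (c : 'I_(\dim C) -> k) :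
    R (\sum_i c i *: e i) (\sum_i c i *: (vbasis C)`_i).
  elim: (index_enum _) => [|i l IH]; first by rewrite !big_nil.
  by rewrite !big_cons addrC [in X in R _ X]addrC; apply: RD.
have Csum (c : 'I_(\dim C) -> k) : \sum_i c i *: (vbasis C)`_i \in C.
  apply: memv_suml => i _; apply: memvZ; apply: vbasis_mem.
  by apply: mem_nth; rewrite size_tuple.
exists e; split=> [i|c Bc|z Zz]; first exact: RZ (eR i).
  apply/freeP; first exact: (basis_free (vbasisP C)).
  apply/eqP; rewrite -memv0 -(capv_diff P Q) memv_cap Csum /=.
  exact/(RB _ _ (Rsum c) (subvP CP _ (Csum c))).
have [z' [u [uP Ru Bz]]] := surR z Zz.
have : u \in (C + P :&: Q)%VS by rewrite addv_diff_cap.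
case/memv_addP=> v vC [q /memv_capP[qP qQ] uE].
exists (fun i => coord (vbasis C) i v).
rewrite -[z](subrK z') -addrA; apply: BD => //.
have := RD (-1) _ _ _ _ Ru (Rsum (fun i => coord (vbasis C) i v)).
rewrite -coord_vbasis // !scaleN1r => Rz; apply/(RB _ _ Rz).
  by rewrite uE addrAC subrr add0r.
by rewrite uE addrAC subrr add0r.
Qed.

(** * Coboundaries and flat cocycles in terms of data *)

Section CochainData.
Variables (k : fieldType) (A : algType k) (d : Order.disp_t) (L : porderType d).
Variable F : presheaf A L.

Lemma eq_cochain1 (D D' : point_data F) (phi phi' : edge_data F) :
  (forall a r, D a r = D' a r) ->
  (forall a b ab, phi a b ab = phi' a b ab) ->
  cochain1 D phi = cochain1 D' phi'.
Proof.
by move=> DD pp; apply: cochainsP => -[|[|p]] [|[|q]] a b c x //=; rewrite ?DD ?pp.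
Qed.

Lemma cochain1_inj (D D' : point_data F) (phi phi' : edge_data F) :
  cochain1 D phi = cochain1 D' phi' ->
  (forall a r, D a r = D' a r) /\ (forall a b ab, phi a b ab = phi' a b ab).
Proof.
move=> E; split=> [a r|a b ab].
  have := congr1 (fun z : cochains F F => z 0 1 a a (point_chain a) [ffun=> r]) E.
  by rewrite /= !psh_res_id !comp_lfun1l ffunE.
have := congr1 (fun z : cochains F F => z 1 0 a b (edge_chain ab) [ffun=> 0]) E.
by rewrite /= !(edge_dataE _ _ ab).
Qed.

Definition coboundary_data (u : forall a, 'End(F a)) : edge_data F :=
  fun a b ab => ((psh_res F ab \o u b) - (u a \o psh_res F ab))%VF.

Lemma coboundary1P z : Tot_coboundary 1 z <->
  exists u, z = cochain1 (fun a => inner_der (u a)) (coboundary_data u).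
Proof.
split=> [[phi /Tot0_cochain0[u ->] ->]|[u ->]].
  by exists u; rewrite tot_diff_cochain0.
by exists (cochain0 u); [apply: Tot_cochain0 | rewrite tot_diff_cochain0].
Qed.

Lemma coboundary1D (z z' : cochains F F) :
  Tot_coboundary 1 z -> Tot_coboundary 1 z' -> Tot_coboundary 1 (z + z').
Proof.
move=> /coboundary1P[u ->] /coboundary1P[u' ->]; apply/coboundary1P.
exists (fun a => u a + u' a); rewrite -[X in _ + X]scale1r cochain1_comb.
apply: eq_cochain1 => [a r|a b ab]; first by rewrite scale1r inner_derD.
rewrite scale1r /coboundary_data comp_lfunDr comp_lfunDl opprD addrACA.
by [].
Qed.

Lemma cochain1_0 :
  cochain1 (fun a _ => 0 : 'End(F a)) (fun a b _ => 0 : 'Hom(F b, F a)) = 0.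
Proof.
by apply: cochainsP => -[|[|p]] [|[|q]] a b c x //=; rewrite comp_lfun0r.
Qed.

Lemma flat_cocycleP (D : point_data F) : (forall a, derivation (D a)) ->
  Tot_cocycle 1 (cochain1 D (fun a b _ => 0 : 'Hom(F b, F a))) <->
  forall a b (ab : (a <= b)%O) r,
    (psh_res F ab \o D b r = D a r \o psh_res F ab)%VF.
Proof.
move=> Dd; have DL : linear_data D by move=> a; apply: (Dd a).1.
have inner0 a b r : inner_der (0 : 'Hom(F b, F a)) r = 0.
  by rewrite /inner_der comp_lfun0l comp_lfun0r subrr.
split=> [/(cochain1_cocycleP _ DL)[_ De _] a b ab r|H].
  have /eqP := De a b ab r; rewrite /edge_defect inner0 sub0r oppr_eq0 subr_eq0.
  by move/eqP.
apply/(cochain1_cocycleP _ DL); split=> // [a b ab r|a m b am mb ab].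
  by rewrite /edge_defect inner0 H subrr subrr.
by rewrite /triangle_defect comp_lfun0l comp_lfun0r subrr addr0.
Qed.

End CochainData.

(** * The presheaf of a sequence *)

Section SequencePresheaf.
Variables (k : fieldType) (A : algType k) (W E V : fdmodule A).
Variables (eps : 'Hom(W, E)) (pi : 'Hom(E, V)).
Hypotheses (Heps : amod_hom eps) (Hpi : amod_hom pi).
Let F := seq_presheaf Heps Hpi.
Local Notation i0 := (@Ordinal 3 0 isT).
Local Notation i1 := (@Ordinal 3 1 isT).
Local Notation i2 := (@Ordinal 3 2 isT).

Definition seq_family (u0 : 'End(V)) (u1 : 'End(E)) (u2 : 'End(W)) n :
  'End(seq_obj W E V n) := match n with 0 => u0 | 1 => u1 | _ => u2 end.

Definition seq_endo u0 u1 u2 (a : 'I_3) : 'End(F a) := seq_family u0 u1 u2 a.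

Lemma seq_edges (P : forall a b : 'I_3, (a <= b)%O -> Prop) :
  P i0 i0 isT -> P i0 i1 isT -> P i0 i2 isT -> P i1 i1 isT -> P i1 i2 isT ->
  P i2 i2 isT -> forall a b ab, P a b ab.
Proof.
move=> P00 P01 P02 P11 P12 P22.
case=> [[|[|[|a]]] Ha] // [[|[|[|b]]] Hb] // ab;
  by rewrite (bool_irrelevance Ha isT) (bool_irrelevance Hb isT)
             (bool_irrelevance ab isT).
Qed.

End SequencePresheaf.

(** * The first extension group of the sequence *)

Section ModularExtension.
Variables (k : fieldType).
Local Notation A := (modular_alg k).
Local Notation x := (modular_x k).
Local Notation y := (modular_y k).
Hypotheses (three_neq0 : 3%:R != 0 :> k) (two_neq0 : 2%:R != 0 :> k).
Variables (W E V : fdmodule A) (eps : 'Hom(W, E)) (pi : 'Hom(E, V)).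
Hypotheses (Heps : amod_hom eps) (Hpi : amod_hom pi).
Hypothesis exact_F : short_exact eps pi.
Let F := seq_presheaf Heps Hpi.
Local Notation i0 := (@Ordinal 3 0 isT).
Local Notation i1 := (@Ordinal 3 1 isT).
Local Notation i2 := (@Ordinal 3 2 isT).
Local Notation p := (parabolic eps pi).

Lemma seq_natural (u : forall a, 'End(F a)) :
  (eps \o (u i2 : 'End(W)) = (u i1 : 'End(E)) \o eps)%VF ->
  (pi \o (u i1 : 'End(E)) = (u i0 : 'End(V)) \o pi)%VF ->
  forall (a b : 'I_3) (ab : (a <= b)%O),
    (psh_res F ab \o u b = u a \o psh_res F ab)%VF.
Proof.
move=> u12 u01; apply: seq_edges => /=; rewrite ?comp_lfun1l ?comp_lfun1r //.
by rewrite -comp_lfunA u12 !comp_lfunA u01.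
Qed.

Definition natural_derivation (D : point_data F) :=
  (forall a, derivation (D a)) /\
  (forall (a b : 'I_3) (ab : (a <= b)%O) r,
     (psh_res F ab \o D b r = D a r \o psh_res F ab)%VF).

Definition zero_edges : edge_data F := fun a b _ => 0.

(** The cocycle z represents the parabolic element u: it deforms the three
    modules compatibly, keeping on E the action of x and changing that of y by
    the infinitesimal conjugation by u. *)
Definition bends (z : cochains F F) (u : 'End(E)) : Prop :=
  exists2 D : point_data F, natural_derivation D &
    [/\ z = cochain1 D zero_edges, D i1 x = 0 & D i1 y = inner_der u y].

Lemma bends0 : bends 0 0.
Proof.
exists (fun a _ => 0).
  split=> [a|a b ab r]; last by rewrite comp_lfun0l comp_lfun0r.
  split=> [c r t|r t]; first by rewrite scaler0 addr0.
  by rewrite comp_lfun0l comp_lfun0r addr0.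
split=> //; first by rewrite cochain1_0.
by rewrite /inner_der comp_lfun0l comp_lfun0r subrr.
Qed.

Lemma bends_comb c z z' u u' :
  bends z u -> bends z' u' -> bends (z + c *: z') (u + c *: u').
Proof.
move=> [D [Dd Dn] [-> Dx Dy]] [D' [Dd' Dn'] [-> Dx' Dy']].
exists (fun a r => D a r + c *: D' a r).
  split=> [a|a b ab r]; first exact: derivation_comb.
  by rewrite comp_lfunDr comp_lfunDl Dn -comp_lfunZr -comp_lfunZl Dn'.
split; last 2 first.
- by rewrite Dx Dx' scaler0 addr0.
- by rewrite inner_derD inner_derZ Dy Dy'.
rewrite cochain1_comb; apply: eq_cochain1 => // a b ab.
by rewrite /zero_edges scaler0 addr0.
Qed.

Lemma bends_cocycle z u : bends z u -> Tot_cocycle 1 z.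
Proof. by move=> [D [Dd Dn] [-> _ _]]; apply/flat_cocycleP. Qed.

Lemma natural_derivation_of (D0 : A -> 'End(V)) (D1 : A -> 'End(E)) (D2 : A -> 'End(W)) :
  derivation D1 -> (forall r, (eps \o D2 r = D1 r \o eps)%VF) ->
  (forall r, (pi \o D1 r = D0 r \o pi)%VF) ->
  natural_derivation (fun a r => seq_endo Heps Hpi (D0 r) (D1 r) (D2 r) a).
Proof.
move=> D1d D12 D01; split=> [|a b ab r]; last first.
  exact: (@seq_natural (seq_endo Heps Hpi (D0 r) (D1 r) (D2 r)) (D12 r) (D01 r)).
have D2d : derivation D2.
  apply: (derivation_eps Heps exact_F).
  have [DL DM] := derivation_compr Heps D1d.
  by split=> [c a b|a b]; rewrite !D12 ?DL ?DM.
have D0d : derivation D0.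
  apply: (derivation_pi Hpi exact_F).
  have [DL DM] := derivation_compl Hpi D1d.
  by split=> [c a b|a b]; rewrite -!D01 ?DL ?DM.
by case=> [[|[|[|a]]] Ha].
Qed.

Lemma parabolic_derivation (D : A -> 'End(E)) : derivation D ->
  D x \in p -> D y \in p -> forall r, D r \in p.
Proof.
move=> Dd /parabolicP Dx /parabolicP Dy r; apply/parabolicP.
apply: (derivation_modular_eq0 (D := fun r => (pi \o D r \o eps)%VF)) => //.
exact/(derivation_compr Heps)/derivation_compl.
Qed.

Lemma inner_der_parabolic u r : u \in p -> inner_der u r \in p.
Proof.
move=> /parabolicP u0; apply/parabolicP.
rewrite -inner_der_compl // -inner_der_compr // u0.
by rewrite /inner_der comp_lfun0l comp_lfun0r subrr.
Qed.

Lemma bends_exists u : u \in p -> exists z, bends z u.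
Proof.
move=> pu.
have [D Dd Dg] := amalgam_derivation (fun b => if b then 0 else u).
have Dx : D x = 0.
  by rewrite (Dg true) /inner_der comp_lfun0l comp_lfun0r subrr.
have Dy : D y = inner_der u y := Dg false.
have Dp : forall r, D r \in p.
  apply: parabolic_derivation => //; rewrite ?Dx ?mem0v // Dy.
  exact: inner_der_parabolic.
have [r [s [re ps one]]] := linear_splitting exact_F.
pose D2 a := (r \o D a \o eps)%VF; pose D0 a := (pi \o D a \o s)%VF.
have DN : natural_derivation (fun a t => seq_endo Heps Hpi (D0 t) (D t) (D2 t) a).
  apply: natural_derivation_of => // a.
    have [t tP] := eps_factor exact_F (etrans (comp_lfunA _ _ _) (parabolicP _ _ _ (Dp a))).
    by rewrite /D2 -!comp_lfunA tP [(r \o _)%VF]comp_lfunA re comp_lfun1l.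
  have [t tP] := pi_factor exact_F (parabolicP _ _ _ (Dp a)).
  by rewrite /D0 tP -[((t \o pi) \o s)%VF]comp_lfunA ps comp_lfun1r.
by exists (cochain1 (fun a t => seq_endo Heps Hpi (D0 t) (D t) (D2 t) a) zero_edges);
  exists (fun a t => seq_endo Heps Hpi (D0 t) (D t) (D2 t) a).
Qed.

(** If the derivation is inner with potential v, then v lies in p, commutes with
    x, and differs from u by an element commuting with y.  Conversely such a v is
    a potential on the generators x and y, hence everywhere. *)
Lemma bends_coboundary z u : bends z u -> u \in p ->
  Tot_coboundary 1 z <->
  u \in (p :&: commutant E E x + p :&: commutant E E y)%VS.
Proof.
move=> [D [Dd Dn] [-> Dx Dy]] up; split.
  move=> /coboundary1P[v /cochain1_inj[Dv phiv]].
  have vp : (v i1 : 'End(E)) \in p.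
    have /esym/eqP := phiv i1 i2 isT; rewrite subr_eq0 => /eqP /= ev.
    by apply/parabolicP; rewrite -comp_lfunA -ev comp_lfunA (pi_eps exact_F) comp_lfun0l.
  rewrite -[u](subrK (v i1 : 'End(E))) addrC; apply: memv_add; rewrite memv_cap.
    by rewrite vp; apply/commutantP; rewrite -Dx Dv.
  by rewrite memvB //; apply/commutantP; rewrite inner_derB -Dy Dv subrr.
move=> /memv_addP[v /memv_capP[vp /commutantP vx] [t /memv_capP[_ /commutantP ty] uE]].
have Dinner r : D i1 r = inner_der v r.
  apply/eqP; rewrite -subr_eq0; apply/eqP.
  have dd : derivation (fun r => D i1 r + (-1) *: inner_der v r).
    exact/derivation_comb/inner_derP.
  have := derivation_modular_eq0 dd; rewrite !scaleN1r Dx Dy vx uE inner_derD ty.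
  by rewrite addr0 !subrr; move=> /(_ erefl erefl r); rewrite scaleN1r.
have [vW [vV [vWP vVP]]] := parabolic_restrict exact_F vp.
apply/coboundary1P; exists (seq_endo Heps Hpi vV v vW).
apply: eq_cochain1 => [a r|a b ab]; last first.
  rewrite /coboundary_data (@seq_natural (seq_endo Heps Hpi vV v vW)) ?subrr //.
have D12 : (eps \o D i2 r = D i1 r \o eps)%VF := Dn i1 i2 isT r.
have D01 : (pi \o D i1 r = D i0 r \o pi)%VF := Dn i0 i1 isT r.
case: a => [[|[|[|a]]] Ha] //=; rewrite (bool_irrelevance Ha isT) //=.
- apply: (pi_cancel exact_F); rewrite -D01 Dinner -inner_der_compl // vVP.
  by rewrite inner_der_compr.
- apply: (eps_cancel exact_F); rewrite D12 Dinner -inner_der_compr // -vWP.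
  by rewrite inner_der_compl.
Qed.

Lemma cyclic_potential_parabolic (D : A -> 'End(E)) g n :
  (forall r, D r \in p) -> cyclic_potential D g n \in p.
Proof.
move=> Dp; rewrite /cyclic_potential memvN memvZ // memv_suml // => i _.
apply/parabolicP; rewrite -comp_lfunA -comp_lfunA -Heps !comp_lfunA.
by rewrite (parabolicP _ _ _ (Dp _)) comp_lfun0l.
Qed.

Lemma derivationB (M N : fdmodule A) (D D' : A -> 'Hom(M, N)) :
  derivation D -> derivation D' -> derivation (fun r => D r - D' r).
Proof.
move=> Dd Dd'; have [DL DM] := derivation_comb (-1) Dd Dd'.
by split=> *; rewrite -!scaleN1r ?DL ?DM.
Qed.

Hypothesis hom_WV : hom_zero W V.

(** The gauge transformation has two parts: v removes the edge data, which is
    possible because pi f1 + f0 eps, the value on the edge from W to V, is zero;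
    then the averaged potential c makes the derivation vanish at x. *)
Lemma bends_up_to_coboundary z : Tot_cocycle 1 z ->
  exists z' u, [/\ u \in p, bends z' u & Tot_coboundary 1 (z - z')].
Proof.
move=> zZ; have [D [phi [DL zE]]] := Tot1_cochain1 zZ.1.
move: zZ; rewrite {}zE => /(cochain1_cocycleP _ DL)[Dd De Dt].
pose DW : A -> 'End(W) := D i2; pose DE : A -> 'End(E) := D i1.
pose DV : A -> 'End(V) := D i0.
pose f1 : 'Hom(W, E) := phi i1 i2 isT; pose f0 : 'Hom(E, V) := phi i0 i1 isT.
have DEd : derivation DE := Dd i1.
(* this edge is A-linear, its defect being a composite through pi eps = 0 *)
have phi02 : phi i0 i2 isT = 0 :> 'Hom(W, V).
  apply: hom_WV; apply/inner_der0P => t; have := De i0 i2 isT t.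
  rewrite /edge_defect /= (pi_eps exact_F) comp_lfun0l comp_lfun0r subrr subr0.
  exact.
have f10 : ((pi \o f1) + (f0 \o eps))%VF = 0.
  have := Dt i0 i1 i2 isT isT isT; rewrite /triangle_defect phi02 subr0.
  exact.
have edge1 r : ((eps \o DW r) - (DE r \o eps))%VF = inner_der f1 r.
  by apply/esym/eqP; rewrite -subr_eq0; apply/eqP/(De i1 i2 isT r).
have edge0 r : ((pi \o DE r) - (DV r \o pi))%VF = inner_der f0 r.
  by apply/esym/eqP; rewrite -subr_eq0; apply/eqP/(De i0 i1 isT r).
have phi_diag a (aa : (a <= a)%O) : phi a a aa = 0.
  have := Dt a a a aa aa aa; rewrite /triangle_defect psh_res_id comp_lfun1l.
  by rewrite comp_lfun1r subrr add0r.
have [r [s [re ps one]]] := linear_splitting exact_F.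
(* the two conditions v eps = - f1 and pi v = f0 are compatible by f10 *)
pose v : 'End(E) := ((s \o f0 \o (\1 - (eps \o r))) - (f1 \o r))%VF.
have ve : (v \o eps)%VF = - f1.
  rewrite comp_lfunDl comp_lfunNl -!comp_lfunA re comp_lfunDl comp_lfunNl.
  by rewrite -comp_lfunA re comp_lfun1l !comp_lfun1r subrr !comp_lfun0r sub0r.
have pv : (pi \o v)%VF = f0.
  rewrite comp_lfunDr comp_lfunNr !comp_lfunA ps comp_lfun1l comp_lfunDr comp_lfunNr.
  rewrite comp_lfun1r comp_lfunA -addrA -opprD -comp_lfunDl [(f0 \o eps)%VF + _]addrC.
  by rewrite f10 comp_lfun0l subr0.
pose D' t := DE t - inner_der v t.
have D'd : derivation D' by exact/(derivationB DEd)/inner_derP.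
have D'e t : (D' t \o eps = eps \o DW t)%VF.
  rewrite comp_lfunDl comp_lfunNl -inner_der_compr // ve inner_derN opprK.
  by rewrite -edge1 addrC subrK.
have D'p t : (pi \o D' t = DV t \o pi)%VF.
  rewrite comp_lfunDr comp_lfunNr -inner_der_compl // pv -edge0.
  by rewrite opprB addrC subrK.
have par t : D' t \in p.
  by apply/parabolicP; rewrite -comp_lfunA D'e comp_lfunA (pi_eps exact_F) comp_lfun0l.
pose c := cyclic_potential D' x 3.
have cp : c \in p by apply: cyclic_potential_parabolic.
have [cW [cV [cWP cVP]]] := parabolic_restrict exact_F cp.
pose D2 t := D' t - inner_der c t.
have D2d : derivation D2 by exact/(derivationB D'd)/inner_derP.
have D2N : natural_derivation (fun a t => seq_endo Heps Hpi
    (DV t - inner_der cV t) (D2 t) (DW t - inner_der cW t) a).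
  apply: natural_derivation_of => // t.
    rewrite comp_lfunDr comp_lfunNr -inner_der_compl // cWP inner_der_compr //.
    by rewrite -D'e /D2 [RHS]comp_lfunDl comp_lfunNl.
  rewrite /D2 comp_lfunDr comp_lfunNr -inner_der_compl // cVP inner_der_compr //.
  by rewrite D'p [RHS]comp_lfunDl comp_lfunNl.
have D2p t : D2 t \in p by rewrite memvB ?inner_der_parabolic.
pose u := cyclic_potential D2 y 2.
exists (cochain1 (fun a t => seq_endo Heps Hpi
  (DV t - inner_der cV t) (D2 t) (DW t - inner_der cW t) a) zero_edges), u.
split.
- exact: cyclic_potential_parabolic.
- exists (fun a t => seq_endo Heps Hpi
    (DV t - inner_der cV t) (D2 t) (DW t - inner_der cW t) a) => //; split=> //.
    by rewrite /= /D2 cyclic_potentialP ?subrr //; apply: modular_x3.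
  by rewrite /= cyclic_potentialP //; apply: modular_y2.
apply/coboundary1P; exists (seq_endo Heps Hpi cV (v + c) cW).
rewrite -[X in _ - X]scale1r -scaleNr cochain1_comb.
apply: eq_cochain1 => [a t|]; last first.
  apply: seq_edges; rewrite /coboundary_data ?phi_diag /zero_edges ?scaler0 addr0 /=.
  - by rewrite comp_lfun1l comp_lfun1r subrr.
  - by rewrite comp_lfunDr pv cVP addrK.
  - by rewrite phi02 (pi_eps exact_F) comp_lfun0l comp_lfun0r subrr.
  - by rewrite comp_lfun1l comp_lfun1r subrr.
  - by rewrite comp_lfunDl ve cWP opprD opprK addrC subrK.
  - by rewrite comp_lfun1l comp_lfun1r subrr.
case: a => [[|[|[|a]]] Ha] //; rewrite (bool_irrelevance Ha isT) /= scaleN1r.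
- by rewrite opprB addrC subrK.
- rewrite -[LHS]/(DE t - (DE t - inner_der v t - inner_der c t)).
  rewrite -[RHS]/(inner_der (v + c) t) (inner_derD v c).
  by rewrite -[DE t - _ - _]addrA -opprD opprB addrC subrK.
- by rewrite opprB addrC subrK.
Qed.

(** * Dimension count *)

Lemma dim_diff_sum (U : vectType k) (P X Y : {vspace U}) :
  (X <= P)%VS -> (Y <= P)%VS ->
  (\dim (P :\: (X + Y)) + \dim X + \dim Y = \dim P + \dim (X :&: Y))%N.
Proof.
move=> XP YP; have sub : (X + Y <= P)%VS by rewrite subv_add XP.
rewrite -(dimv_cap_compl P (X + Y)) (capv_idPr sub) -addnA -dimv_sum_cap.
by rewrite addnA [(\dim (_ :\: _) + _)%N]addnC.
Qed.

Lemma ext1_parabolic :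
  ext_dim F F 1 (\dim (p :\: (p :&: commutant E E x + p :&: commutant E E y))%VS).
Proof.
apply: (quotient_dim_correspondence (R := bends)).
- by rewrite subv_add; apply/andP; split; apply: capvSl.
- exact: coboundary1D.
- exact: bends_comb.
- exact: bends0.
- exact: bends_cocycle.
- exact: bends_exists.
- exact: bends_up_to_coboundary.
- exact: bends_coboundary.
Qed.

Lemma dim_commutant1 (M N : fdmodule A) :
  \dim (commutant M N 1) = (\dim {:M} * \dim {:N})%N.
Proof.
rewrite (_ : commutant M N 1 = fullv) ?dimvf //.
apply/eqP; rewrite eqEsubv subvf; apply/subvP=> u _; apply/commutantP.
exact/derivation1/inner_derP.
Qed.

Lemma dim_parabolic : \dim p =
  (\dim {:W} * \dim {:W} + \dim {:V} * \dim {:V} + \dim {:V} * \dim {:W})%N.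
Proof.
rewrite -!dim_commutant1 -(dim_parabolic_commutant Heps Hpi exact_F (n := 1)) ?oner_neq0 //.
congr (\dim _); apply/esym/capv_idPl/subvP=> u _; apply/commutantP.
exact/derivation1/inner_derP.
Qed.

Hypothesis nonsplit_F : ~ split_epi pi.
Hypothesis hom_VW : hom_zero V W.
Hypotheses (end_V : end_iso_base V) (end_W : end_iso_base W).

(** Commuting with x and y means being A-linear, so the intersection is the
    endomorphism algebra of E. *)
Lemma dim_invariant_parabolic :
  \dim (p :&: commutant E E x :&: (p :&: commutant E E y))%VS = 1%N.
Proof.
have -> : (p :&: commutant E E x :&: (p :&: commutant E E y))%VS = <[\1%VF]>%VS.
  apply/eqP; rewrite eqEsubv; apply/andP; split; apply/subvP=> u.
    move=> /memv_capP[/memv_capP[up /commutantP ux] /memv_capP[_ /commutantP uy]].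
    apply/vlineP; apply: (end_extension_scalar Heps Hpi exact_F) => //.
    exact: amod_hom_modular.
  move=> /vlineP[c ->]; have Hc : amod_hom (c *: \1%VF : 'End(E)).
    exact/amod_homZ/amod_hom1.
  have cp := amod_hom_parabolic Heps Hpi hom_WV Hc.
  have comm a : c *: \1%VF \in commutant E E a.
    exact/commutantP/((inner_der0P _).1 Hc).
  by do 2![apply/memv_capP; split] => //; apply/memv_capP; split.
by rewrite dim_vline (end_extension_neq0 exact_F end_V).
Qed.

Lemma dim_ext1 a b c :
  \dim (p :&: commutant E E x) = a -> \dim (p :&: commutant E E y) = b ->
  \dim p = c ->
  (\dim (p :\: (p :&: commutant E E x + p :&: commutant E E y))%VS + a + b
   = c + 1)%N.
Proof.
by move=> <- <- <-; rewrite dim_diff_sum ?capvSl // dim_invariant_parabolic.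
Qed.

End ModularExtension.

Lemma euler_count (n : nat) (b c : dimvec) :
  (n + (\sum_i b.1 i * b.1 i + \sum_i c.1 i * c.1 i + \sum_i c.1 i * b.1 i)
     + (\sum_i b.2 i * b.2 i + \sum_i c.2 i * c.2 i + \sum_i c.2 i * b.2 i)
   = (\sum_i b.1 i) * (\sum_i b.1 i) + (\sum_i c.1 i) * (\sum_i c.1 i)
     + (\sum_i c.1 i) * (\sum_i b.1 i) + 1)%N ->
  n%:Z = 1 - euler_form (b + c) (b + c) + euler_form b c.
Proof.
have E1 i : (b + c).1 i = (b.1 i + c.1 i)%N by rewrite ffunE.
have E2 i : (b + c).2 i = (b.2 i + c.2 i)%N by rewrite ffunE.
rewrite /euler_form !big_ord_recr !big_ord0 /= !E1 !E2.
move/(congr1 Posz); rewrite !(PoszD, PoszM) => En.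
set m := (X in X = _) in En; apply: (addIr (m - n%:Z)).
by rewrite [LHS]addrC subrK {1}En /m; ring.
Qed.

Theorem proposition3p3
  (k : closedFieldType) (char0 : [pchar k] =i pred0)
  (w : 3.-tuple k) (uw : uniq w) (w_root : all 3.-unity_root w)
  (s : 2.-tuple k) (us : uniq s) (s_root : all 2.-unity_root s)
  (W E V : fdmodule (modular_alg k))
  (eps : 'Hom(W, E)) (pi : 'Hom(E, V))
  (Heps : amod_hom eps) (Hpi : amod_hom pi)
  (exact_F : short_exact eps pi) (nonsplit_F : ~ split_epi pi)
  (hom_VW : hom_zero V W) (hom_WV : hom_zero W V)
  (end_V : end_iso_base V) (end_W : end_iso_base W) :
  let F := seq_presheaf Heps Hpi in
  let beta := dim_vector w s W in
  let gamma := dim_vector w s V in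
  exists n : nat, ext_dim F F 1 n /\
    n%:Z = 1 - euler_form (beta + gamma) (beta + gamma) + euler_form beta gamma.
Proof.
move=> F beta gamma.
have three_neq0 : 3%:R != 0 :> k by rewrite (pcharf0P _).1.
have two_neq0 : 2%:R != 0 :> k by rewrite (pcharf0P _).1.
have x3 := modular_x3 k; have y2 := modular_y2 k.
eexists; split.
  exact: (ext1_parabolic three_neq0 two_neq0 Heps Hpi exact_F hom_WV).
apply: euler_count.
have b1 i : \dim (eigen w (modular_x k) W i) = beta.1 i by rewrite ffunE.
have c1 i : \dim (eigen w (modular_x k) V i) = gamma.1 i by rewrite ffunE.
have b2 i : \dim (eigen s (modular_y k) W i) = beta.2 i by rewrite ffunE.
have c2 i : \dim (eigen s (modular_y k) V i) = gamma.2 i by rewrite ffunE.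
apply: dim_ext1 => //.
- rewrite (dim_parabolic_eigen Heps Hpi exact_F three_neq0 uw w_root x3).
  by congr (_ + _ + _)%N; apply: eq_bigr => i _; rewrite ?b1 ?c1.
- rewrite (dim_parabolic_eigen Heps Hpi exact_F two_neq0 us s_root y2).
  by congr (_ + _ + _)%N; apply: eq_bigr => i _; rewrite ?b2 ?c2.
rewrite (dim_parabolic Heps Hpi exact_F).
rewrite -(dim_eigen_sum three_neq0 uw w_root x3 W).
rewrite -(dim_eigen_sum three_neq0 uw w_root x3 V).
by rewrite (eq_bigr _ (fun i _ => b1 i)) (eq_bigr _ (fun i _ => c1 i)).
Qed.
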